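(* Let $\mathcal{C}$ be the category of uniformly discrete bounded geometry metric spaces with morphisms the closeness classes of coarse equivalences, and let $\mathcal{R}$ be the category with the same objects and with morphisms the closeness classes of unitary isomorphisms $U:l^2(X,\mathcal{H})\to l^2(Y,\mathcal{H})$ such that $T\mapsto UTU^*$ defines an isomorphism $\mathbb{C}[X]\to\mathbb{C}[Y]$ (see context for the precise definitions). Provisionally define functors $$\mathcal{F}:\mathcal{R}\to\mathcal{C}\quad\text{and}\quad \mathcal{U}:\mathcal{C}\to\mathcal{R}$$ as follows: each is the identity on objects; $\mathcal{F}[U]$ is the class in $\mathcal{C}$ of any coarse equivalence covered by $U$; $\mathcal{U}[f]$ is the class in $\mathcal{R}$ of any unitary isomorphism (morphism of $\mathcal{R}_0$) covering $f$. Then $\mathcal{F}$ and $\mathcal{U}$ are well-defined and are mutually inverse isomorphisms of categories.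
   Context: A metric space $X$ has bounded geometry if for all $R\ge 0$ there is $N_R\in\mathbb{N}$ such that every ball of radius $R$ in $X$ has at most $N_R$ elements. A (not necessarily continuous) map $f:X\to Y$ of metric spaces is uniformly expansive if for all $R>0$ there is $S>0$ such that $d(x_1,x_2)\le R$ implies $d(f(x_1),f(x_2))\le S$. Two maps $f,g:X\to Y$ are close if there is $C>0$ with $d(f(x),g(x))\le C$ for all $x\in X$. A coarse equivalence is a uniformly expansive map $f:X\to Y$ for which there is a uniformly expansive map $g:Y\to X$ such that $f\circ g$ and $g\circ f$ are close to the identity maps. Fix a separable infinite dimensional complex Hilbert space $\mathcal{H}$. For a bounded operator $T:l^2(X,\mathcal{H})\to l^2(Y,\mathcal{H})$ write $T_{yx}$ for its $(y,x)$ matrix coefficient, a bounded operator on $\mathcal{H}$. A bounded operator $T$ on $l^2(X,\mathcal{H})$ has finite propagation if there is $S>0$ such that $T_{xy}=0$ whenever $d(x,y)\ge S$. The algebraic Roe algebra $\mathbb{C}[X]$ is the $*$-algebra of all finite propagation bounded operators $T$ on $l^2(X,\mathcal{H})$ such that every $T_{xy}$ is compact. Category $\mathcal{C}_0$: objects are uniformly discrete, bounded geometry metric spaces; morphisms are coarse equivalences. $\mathcal{C}$ is the quotient category of $\mathcal{C}_0$ by the closeness relation on morphisms. Two unitary isomorphisms $U,V:l^2(X,\mathcal{H})\to l^2(Y,\mathcal{H})$ are close if $U^*V$ is a finite propagation operator on $l^2(X,\mathcal{H})$. Category $\mathcal{R}_0$: objects are uniformly discrete, bounded geometry metric spaces;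 morphisms from $X$ to $Y$ are unitary isomorphisms $U:l^2(X,\mathcal{H})\to l^2(Y,\mathcal{H})$ such that $T\mapsto UTU^*$ defines an isomorphism $\mathbb{C}[X]\to\mathbb{C}[Y]$. $\mathcal{R}$ is the quotient category of $\mathcal{R}_0$ by closeness. Covering: if $f:X\to Y$ is a coarse equivalence and $U:l^2(X,\mathcal{H})\to l^2(Y,\mathcal{H})$ a unitary isomorphism, then $U$ covers $f$ if there is $C\ge0$ such that for all $x\in X$, $y\in Y$, $U_{yx}\neq0$ implies $d(f(x),y)\le C$. *)

(* Defs.v *)
From HB Require Import structures.
From mathcomp Require Import all_boot all_order all_algebra finmap.
From mathcomp Require Import complex ring lra.
From mathcomp Require Import all_classical all_reals topology normedtype.
From mathcomp Require Import summability.

Set Implicit Arguments.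
Unset Strict Implicit.
Unset Printing Implicit Defensive.

Import Order.TTheory GRing.Theory Num.Theory numFieldNormedType.Exports.
Local Open Scope classical_set_scope.
Local Open Scope ring_scope.
Local Open Scope quotient_scope.

#[local] Existing Instance totally_filter.

Section dot_norm.
Variables (K : numClosedFieldType) (V : lmodType K) (form : {dot V for @Num.conj K}).

Let formC u v : form u v = (form v u)^*.
Proof. by rewrite hermC expr0 mul1r. Qed.

Lemma dot_cauchy_schwarz u v : `|form u v| ^+ 2 <= form u u * form v v.
Proof.
have [->|v0] := eqVneq v 0.
  by rewrite linear0r normr0 expr0n mulr_ge0 ?dnorm_ge0.
have vv0 : 0 < form v v by rewrite dnorm_gt0.
pose a := form u v / form v v; pose w := u - a *: v.
have wv : form w v = 0.
  by rewrite linearBl linearZl_LR /= divfK ?subrr// gt_eqF.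
have uE : u = a *: v + w by rewrite /w addrC subrK.
rewrite -ler_pdivrMr//.
have vw : form v w = 0 by rewrite formC wv conjC0.
have avw : form (a *: v) w = 0.
  by have /= -> := linearZl_LR form w a v; rewrite [X in _ * X]vw mulr0.
have uu : form u u = `|a| ^+ 2 * form v v + form w w.
  rewrite {1 2}uE hnormDd//; congr (_ + _); exact: dnormZ.
rewrite uu /a normf_div (ger0_norm (ltW vv0)) expr_div_n.
rewrite [form v v ^+ 2]expr2 invfM mulrA divfK ?gt_eqF//.
by rewrite lerDl dnorm_ge0.
Qed.

Lemma dot_triangle u v :
  sqrtC (form (u + v) (u + v)) <= sqrtC (form u u) + sqrtC (form v v).
Proof.
rewrite -(ler_pXn2r (n := 2)) ?nnegrE ?addr_ge0 ?sqrtC_ge0 ?dnorm_ge0//.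
rewrite sqrrD !sqrtCK dnormD [leRHS]addrAC lerD2l -mulr_natl.
rewrite -[X in X <= _](divfK (negbT (pnatr_eq0 K 2))) -ReE mulrC.
rewrite ler_pM2l ?ltr0n//.
have [/le_trans-> //] := leif_Re_Creal (form u v).
rewrite -(ler_pXn2r (n := 2)) ?nnegrE ?mulr_ge0 ?sqrtC_ge0 ?dnorm_ge0//.
by rewrite exprMn !sqrtCK dot_cauchy_schwarz.
Qed.

End dot_norm.

(* {dot V for conj} is linear in its first argument, conjugate-linear in the
   second one, Hermitian and positive definite. *)
HB.mixin Record NormedModule_hasInner (K : numClosedFieldType) V & NormedModule K V := {
  inner : {dot V for @Num.conj K} ;
  inner_norm : forall u, inner u u = `|u| ^+ 2
}.
#[short(type="innerProductModType")]
HB.structure Definition InnerProductModule (K : numClosedFieldType) :=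
  {V of NormedModule K V & NormedModule_hasInner K V}.
#[short(type="hilbertType")]
HB.structure Definition Hilbert (K : numClosedFieldType) :=
  {V of CompleteNormedModule K V & NormedModule_hasInner K V}.

HB.factory Record Lmodule_hasInner (K : numClosedFieldType) V & GRing.Lmodule K V := {
  inner : {dot V for @Num.conj K}
}.
HB.builders Context K V & Lmodule_hasInner K V.

Let norm (u : V) : K := sqrtC (inner u u).

Let normrZ (l : K) (u : V) : norm (l *: u) = `|l| * norm u.
Proof. by rewrite /norm dnormZ sqrtCM ?nnegrE ?exprn_ge0 ?dnorm_ge0// sqrCK. Qed.

Let normr0_eq0 (u : V) : norm u = 0 -> u = 0.
Proof. by move/eqP; rewrite sqrtC_eq0 dnorm_eq0 => /eqP. Qed.

HB.instance Definition _ :=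
  Lmodule_isNormed.Build K V (dot_triangle inner) normrZ normr0_eq0.
HB.instance Definition _ :=
  NormedModule_hasInner.Build K V (fun u => esym (sqrtCK (inner u u))).
HB.end.

Section summation.
Variables (R : realType) (X : choiceType).
Local Open Scope complex_scope.

Lemma cvg_real_complex T (F : set_system T) (FF : Filter F) (u : T -> R) (l : R) :
  u @ F --> l -> ((u t)%:C : R[i]^o) @[t --> F] --> (l%:C : R[i]^o).
Proof.
move=> ul; apply/cvgrPdist_le => -[e e'] /=; rewrite ltcE /= => /andP[/eqP -> e0].
have /cvgrPdist_le/(_ _ e0) := ul; apply: filterS => t.
by rewrite -rmorphB/= normc_def /= expr0n addr0 sqrtr_sqr lecR.
Qed.

Lemma partial_sumE (V : zmodType) (a : X -> V) (J : {fset X}) :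
  partial_sum a J = \sum_(x <- J) a x.
Proof. by rewrite /partial_sum big_seq_fsetE. Qed.

Lemma cvg_sum_ge0 (b : X -> R) (M : R) : (forall x, 0 <= b x) ->
    (forall J : {fset X}, \sum_(x <- J) b x <= M) ->
  exists2 l : R, partial_sum b @ totally --> l & forall x, b x <= l.
Proof.
move=> b0 bM; pose E := range (partial_sum b).
have supE : has_sup E.
  split; first by exists (partial_sum b fset0), fset0.
  by exists M => _ [J _ <-]; rewrite partial_sumE.
exists (sup E); last first.
  move=> x; apply: (ub_le_sup supE.2); exists [fset x]%fset => //.
  by rewrite partial_sumE big_seq_fset1.
apply/cvgrPdist_le => e e0.
have [_ [J _ <-] J_gt] := sup_adherent e0 supE.
exists J => // J' /= JJ'.
have J'le : partial_sum b J' <= sup E by apply: (ub_le_sup supE.2); exists J'.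
have JleJ' : partial_sum b J <= partial_sum b J'.
  rewrite !partial_sumE (big_fsetID _ (mem J) J').
  rewrite (_ : [fset x | x in J' & _]%fset = J); last first.
    apply/fsetP => x; rewrite !inE /= andbC.
    by case xJ: (x \in J) => //=; rewrite (fsubsetP JJ').
  by rewrite lerDl sumr_ge0.
rewrite ger0_norm ?subr_ge0//; lra.
Qed.

Lemma cvg_sum_complex (a : X -> R[i]^o) (M : R[i]) :
    (forall J : {fset X}, \sum_(x <- J) `|a x| <= M) ->
  cvg (partial_sum a @ totally).
Proof.
move=> aM.
have M_ge0 : 0 <= M by have := aM fset0; rewrite big_seq_fset0.
have bnd (b : X -> R) : (forall x, 0 <= b x) -> (forall x, (b x)%:C <= `|a x|) ->
    exists l : R, partial_sum b @ totally --> l.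
  move=> b0 ba; have [|l ? _] := @cvg_sum_ge0 b (complex.Re M) b0; last by exists l.
  move=> J; rewrite -lecR RRe_real ?ger0_real// rmorph_sum/=.
  by apply: le_trans (aM J); apply: ler_sum => x _; exact: ba.
have ReIm x : `|complex.Re (a x)|%:C <= `|a x| /\ `|complex.Im (a x)|%:C <= `|a x|.
  split; first exact: normc_ge_Re.
  rewrite normc_def lecR -[leLHS]sqrtr_sqr ler_wsqrtr//.
  by rewrite lerDr sqr_ge0.
have part (c : X -> R) : (forall x, `|c x|%:C <= `|a x|) ->
    exists l : R, partial_sum c @ totally --> l.
  move=> ca.
  have [||p hp] := bnd (fun x => (`|c x| + c x) / 2).
  - by move=> x; have := ler_norm (- c x); rewrite normrN; lra.
  - move=> x; apply: le_trans (ca x); rewrite lecR.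
    by have := ler_norm (c x); lra.
  have [||q hq] := bnd (fun x => (`|c x| - c x) / 2).
  - by move=> x; have := ler_norm (c x); lra.
  - move=> x; apply: le_trans (ca x); rewrite lecR.
    by have := ler_norm (- c x); rewrite normrN; lra.
  exists (p - q); rewrite (_ : partial_sum c = partial_sum (fun x => (`|c x| + c x) / 2)
      - partial_sum (fun x => (`|c x| - c x) / 2)); first exact: cvgB.
  apply/funext => J; rewrite !fctE !partial_sumE -sumrB.
  by apply: eq_bigr => x _; lra.
have [r hr] := part _ (fun x => (ReIm x).1).
have [s hs] := part _ (fun x => (ReIm x).2).
apply/cvg_ex; exists (r%:C + 'i * s%:C).
rewrite (_ : partial_sum a = (fun J => (partial_sum (fun x => complex.Re (a x)) J)%:C : R[i]^o)
    + (fun J => ('i : R[i]^o) * ((partial_sum (fun x => complex.Im (a x)) J)%:C : R[i]^o))).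
  apply: cvgD; first exact: cvg_real_complex.
  by apply: cvgMr; exact: cvg_real_complex.
apply/funext => J; rewrite !fctE !partial_sumE !rmorph_sum /= mulr_sumr -big_split/=.
by apply: eq_bigr => x _; rewrite -complexE.
Qed.

End summation.

Section l2_def.
Variables (K : numClosedFieldType) (X : choiceType) (H : normedModType K).

(* The finite partial sums of `|f x| ^+ 2 are bounded, i.e. the unordered sum of
   this nonnegative family is finite. *)
Definition square_summable : {pred X -> H} := [pred f |
  `[< exists M : K, forall J : {fset X}, \sum_(x <- J) `|f x| ^+ 2 <= M >] ].

Record l2 := L2 { l2_fun :> X -> H ; _ : l2_fun \in square_summable }.

HB.instance Definition _ := [isSub for l2_fun].
HB.instance Definition _ := [Choice of l2 by <:].

Lemma square_summable_submod : submod_closed square_summable.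
Proof.
split.
  by apply/asboolP; exists 0 => J; rewrite big1// => x _; rewrite normr0 expr0n.
move=> a f g /asboolP[M fM] /asboolP[N gN]; apply/asboolP.
exists (2 * `|a| ^+ 2 * M + 2 * N) => J.
apply: (@le_trans _ _ (2 * `|a| ^+ 2 * \sum_(x <- J) `|f x| ^+ 2
                       + 2 * \sum_(x <- J) `|g x| ^+ 2)); last first.
  apply: lerD; apply: ler_wpM2l => //; by rewrite mulr_ge0// exprn_ge0.
rewrite !mulr_sumr -big_split/=; apply: ler_sum => x _.
apply: (@le_trans _ _ ((`|a| * `|f x| + `|g x|) ^+ 2)).
  rewrite ler_pXn2r ?nnegrE ?addr_ge0 ?mulr_ge0// -normrZ.
  exact: ler_normD.
rewrite -subr_ge0 (_ : _ - _ = (`|a| * `|f x| - `|g x|) ^+ 2); last by ring.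
rewrite -real_normK ?exprn_ge0//; apply: realB; last exact: normr_real.
by apply: realM; exact: normr_real.
Qed.

HB.instance Definition _ :=
  GRing.isSubmodClosed.Build K (X -> H) square_summable square_summable_submod.
HB.instance Definition _ := [SubChoice_isSubLmodule of l2 by <:].

End l2_def.

Section l2_inner.
Variables (R : realType) (X : choiceType) (H : innerProductModType R[i]).
Implicit Types f g h : l2 X H.

Lemma l2P f : exists M, forall J : {fset X}, \sum_(x <- J) `|f x| ^+ 2 <= M.
Proof. by case: f => f /= /asboolP. Qed.

(* summability.sum is the unordered sum: the limit of the finite partial sums
   along the finite subsets of X, ordered by inclusion. It is absolutely
   convergent here (cvg_l2_inner). *)
Definition l2_inner f g : R[i] :=
  summability.sum (fun x => inner (f x) (g x) : R[i]^o).

Lemma cvg_l2_inner f g :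
  partial_sum (fun x => inner (f x) (g x) : R[i]^o) @ totally --> (l2_inner f g : R[i]^o).
Proof.
have [[M fM] [N gN]] := (l2P f, l2P g).
apply: (@cvg_sum_complex _ _ _ (M + N)) => J.
apply: le_trans (lerD (fM J) (gN J)).
rewrite -big_split /=; apply: ler_sum => x _.
apply: (@le_trans _ _ (`|f x| * `|g x|)).
  rewrite -(ler_pXn2r (n := 2)) ?nnegrE ?mulr_ge0 // exprMn -!inner_norm.
  exact: dot_cauchy_schwarz.
rewrite -subr_ge0; set a := `|f x|; set b := `|g x|.
rewrite (_ : _ - _ = ((a - b) ^+ 2 + a ^+ 2 + b ^+ 2) / 2%:R); last by field.
have ab : a - b \is Num.real by apply: realB; exact: normr_real.
apply: divr_ge0 => //; apply: addr_ge0; last exact/exprn_ge0/normr_ge0.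
by apply: addr_ge0; [exact: real_exprn_even_ge0|exact/exprn_ge0/normr_ge0].
Qed.

Lemma l2_inner_unique f g (l : R[i]^o) :
  partial_sum (fun x => inner (f x) (g x) : R[i]^o) @ totally --> l -> l2_inner f g = l.
Proof.
move=> fgl; exact: (@cvg_lim R[i]^o (@norm_hausdorff _ R[i]^o) _ _ _ _ _ fgl).
Qed.

Let l2_inner_linear h : linear_for *%R (l2_inner ^~ h : l2 X H -> R[i]).
Proof.
move=> a f g /=; apply: l2_inner_unique.
rewrite (_ : partial_sum _ = (fun J => (a : R[i]^o) *
     partial_sum (fun x => inner (f x) (h x) : R[i]^o) J)
   + partial_sum (fun x => inner (g x) (h x) : R[i]^o)).
  apply: cvgD; last exact: cvg_l2_inner.
  by apply: cvgMr; exact: cvg_l2_inner.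
apply/funext => J; rewrite !fctE !partial_sumE mulr_sumr -big_split/=.
by apply: eq_bigr => x _; rewrite linearDl /= linearZl_LR.
Qed.

Let l2_inner_conj f g : l2_inner f g = (-1) ^+ false * Num.conj (l2_inner g f).
Proof.
rewrite expr0 mul1r; apply: l2_inner_unique.
rewrite (_ : partial_sum _ = (fun J => Num.conj
  (partial_sum (fun x => inner (g x) (f x) : R[i]^o) J) : R[i]^o)).
  have /cvgrPdist_le gf := @cvg_l2_inner g f.
  by apply/cvgrPdist_le => e /gf; apply: filterS => J; rewrite -rmorphB norm_conjC.
apply/funext => J; rewrite !partial_sumE rmorph_sum/=.
by apply: eq_bigr => x _; rewrite hermC expr0 mul1r.
Qed.

Let l2_inner_linear_r f : linear_for (@Num.conj R[i] \; *%R) (l2_inner f : l2 X H -> R[i]).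
Proof.
move=> a g h /=; rewrite ![l2_inner f _]l2_inner_conj !expr0 !mul1r.
by rewrite l2_inner_linear rmorphD rmorphM.
Qed.

Let l2_inner_gt0 f : f != 0 -> 0 < l2_inner f f.
Proof.
move=> f0.
have [x fx0] : exists x, f x != 0.
  apply: contrapT => /forallNP fx; move/eqP: f0; apply; apply: val_inj => /=.
  by apply/funext => x /=; have /negP/negPn/eqP := fx x.
have [M fM] := l2P f.
pose b y := complex.Re (inner (f y) (f y)).
have bE y : ((b y)%:C)%C = inner (f y) (f y).
  by rewrite RRe_real// ger0_real// inner_norm exprn_ge0.
have b0 y : 0 <= b y by rewrite -lecR bE inner_norm exprn_ge0.
have [|l bl ble] := @cvg_sum_ge0 _ _ b (complex.Re M) b0.
  move=> J; have := fM J; rewrite lecE => /andP[_]; apply: le_trans.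
  rewrite raddf_sum/=; apply: ler_sum => y _; by rewrite /b inner_norm.
have -> : l2_inner f f = (l%:C)%C.
  apply: l2_inner_unique; rewrite (_ : partial_sum _ =
    (fun J => ((partial_sum b J)%:C)%C : R[i]^o)); first exact: cvg_real_complex.
  apply/funext => J.
  by rewrite !partial_sumE rmorph_sum; apply: eq_bigr => y _; rewrite -bE.
rewrite ltcR; apply: lt_le_trans (ble x).
by rewrite -ltcR bE inner_norm exprn_gt0 ?normr_gt0.
Qed.

HB.instance Definition _ := @bilinear_isBilinear.Build R[i] (l2 X H) (l2 X H) R[i]
  *%R (@Num.conj R[i] \; *%R) l2_inner (l2_inner_linear, l2_inner_linear_r).
HB.instance Definition _ := @isHermitianSesquilinear.Build R[i] (l2 X H) false
  (@Num.conj R[i]) l2_inner l2_inner_conj.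
HB.instance Definition _ := @isDotProduct.Build R[i] (l2 X H) l2_inner l2_inner_gt0.

HB.instance Definition _ := @Lmodule_hasInner.Build R[i] (l2 X H) l2_inner.

End l2_inner.

Definition separable_space (T : topologicalType) :=
  exists2 A : set T, countable A & dense A.

Definition infinite_dimensional (K : numFieldType) (V : lmodType K) :=
  ~ exists n (e : 'I_n -> V), forall v, exists c : 'I_n -> K, v = \sum_i c i *: e i.

Section operators.
Variable K : numClosedFieldType.

Definition bounded_operator (E F : normedModType K) (T : E -> F) :=
  linear T /\ exists M : K, forall v, `|T v| <= M * `|v|.

Definition compact_operator (E F : normedModType K) (T : E -> F) :=
  bounded_operator T /\ compact (closure (T @` [set v | `|v| <= 1])).

Definition adjoint (E F : innerProductModType K) (T : E -> F) (S : F -> E) :=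
  forall u v, inner (T u) v = inner u (S v).

(* unitary_adj U is the adjoint U^*, and the two cancellation laws say that
   U^*U = 1 and UU^* = 1. *)
Record unitary (E F : innerProductModType K) := Unitary {
  unitary_fun :> E -> F;
  unitary_adj : F -> E;
  unitary_linear : linear unitary_fun;
  unitary_adjP : adjoint unitary_fun unitary_adj;
  unitary_funK : cancel unitary_fun unitary_adj;
  unitary_adjK : cancel unitary_adj unitary_fun
}.

Lemma unitary_eq (E F : innerProductModType K) (U V : unitary E F) :
  U = V :> (E -> F) -> U = V.
Proof.
case: U V => [U U' Ul Ua UK U'K] [V V' Vl Va VK V'K] /= UV.
have UV' : U' = V' by apply/funext => v; rewrite -[in LHS](V'K v) -UV UK.
case: _ / UV UV' Vl Va VK V'K => UV'; case: _ / UV' => Vl Va VK V'K.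
by congr Unitary; exact: Prop_irrelevance.
Qed.

Definition unitary_id (E : innerProductModType K) : unitary E E.
Proof. by exists id id. Defined.

Definition unitary_comp (E F G : innerProductModType K) (V : unitary F G)
  (U : unitary E F) : unitary E G.
Proof.
exists (V \o U) (unitary_adj U \o unitary_adj V).
- by move=> a u v /=; rewrite !unitary_linear.
- by move=> u v /=; rewrite !unitary_adjP.
- by move=> u /=; rewrite !unitary_funK.
- by move=> v /=; rewrite !unitary_adjK.
Defined.

Definition unitary_conj (E F : innerProductModType K) (U : unitary E F)
  (T : E -> E) : F -> F := U \o T \o unitary_adj U.

(* Isomorphism of *-algebras of operators; for such algebras A and B, the
   sum, scalar multiples, product and adjoint are those of operators. *)
Definition star_isomorphism (E F : innerProductModType K)
    (A : set (E -> E)) (B : set (F -> F)) (phi : (E -> E) -> (F -> F)) :=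
  [/\ set_bij A B phi,
      forall S T, A S -> A T -> phi (S \+ T) = phi S \+ phi T,
      forall a T, A T -> phi (a \*: T) = a \*: phi T,
      forall S T, A S -> A T -> phi (S \o T) = phi S \o phi T
    & forall S T, A S -> A T -> adjoint S T -> adjoint (phi S) (phi T)].

Lemma star_isomorphism_id (E : innerProductModType K) (A : set (E -> E)) :
  star_isomorphism A A id.
Proof. by split=> //; split=> // T AT; exists T. Qed.

Lemma star_isomorphism_comp (E F G : innerProductModType K) (A : set (E -> E))
    (B : set (F -> F)) (D : set (G -> G))
    (phi : (E -> E) -> (F -> F)) (psi : (F -> F) -> (G -> G)) :
  star_isomorphism A B phi -> star_isomorphism B D psi ->
  star_isomorphism A D (psi \o phi).
Proof.
move=> [phiAB phiD phiZ phiM phiA] [psiBD psiD psiZ psiM psiA].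
have AB T : A T -> B (phi T) by case: phiAB => + _ _; apply.
split=> /=.
- exact: set_bij_comp phiAB psiBD.
- by move=> S T AS AT; rewrite phiD// psiD//; exact: AB.
- by move=> a T AT; rewrite phiZ// psiZ//; exact: AB.
- by move=> S T AS AT; rewrite phiM// psiM//; exact: AB.
- by move=> S T AS AT ST; apply: psiA; [exact: AB|exact: AB|exact: phiA].
Qed.

End operators.

Section l2_delta.
Variables (K : numClosedFieldType) (X : choiceType) (H : normedModType K).

Lemma l2_delta_subproof (x : X) (v : H) :
  (fun y => if y == x then v else 0) \in @square_summable K X H.
Proof.
apply/asboolP; exists (`|v| ^+ 2) => J; have [xJ|xJ] := boolP (x \in J).
  rewrite (big_fsetD1 x)//= eqxx big_seq big1 ?addr0// => y.
  by rewrite !inE => /andP[/negPf -> _]; rewrite normr0 expr0n.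
rewrite big_seq big1 ?exprn_ge0// => y yJ.
by case: eqP yJ xJ => [-> ->//|_ _ _]; rewrite normr0 expr0n.
Qed.

Definition l2_delta (x : X) (v : H) : l2 X H := L2 (l2_delta_subproof x v).

End l2_delta.

Record category := Category {
  obj :> Type;
  mor : obj -> obj -> Type;
  mor_id : forall X, mor X X;
  mor_comp : forall X Y Z, mor Y Z -> mor X Y -> mor X Z;
  mor_comp_idl : forall X Y (f : mor X Y), mor_comp (mor_id Y) f = f;
  mor_comp_idr : forall X Y (f : mor X Y), mor_comp f (mor_id X) = f;
  mor_compA : forall W X Y Z (h : mor Y Z) (g : mor X Y) (f : mor W X),
    mor_comp h (mor_comp g f) = mor_comp (mor_comp h g) f
}.
Arguments mor {c}.
Arguments mor_id {c}.
Arguments mor_comp {c X Y Z}.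

Definition functorial (C D : category) (F0 : C -> D)
    (F1 : forall X Y, mor X Y -> mor (F0 X) (F0 Y)) : Prop :=
  (forall X, F1 X X (mor_id X) = mor_id (F0 X)) /\
  (forall X Y Z (g : mor Y Z) (f : mor X Y),
    F1 X Z (mor_comp g f) = mor_comp (F1 Y Z g) (F1 X Y f)).

Record functor (C D : category) := Functor {
  fobj :> C -> D;
  fmap : forall X Y, mor X Y -> mor (fobj X) (fobj Y);
  fmapP : functorial fmap
}.
Arguments fmap {C D} _ {X Y} _.

Definition id_functor (C : category) : functor C C.
Proof. by exists id (fun X Y => id). Defined.

Definition comp_functor (C D E : category) (G : functor D E) (F : functor C D) :
  functor C E.
Proof.
exists (fun X => G (F X)) (fun X Y f => fmap G (fmap F f)).
by split=> [X|X Y Z g f]; rewrite ?(fmapP F).1 ?(fmapP F).2 ?(fmapP G).1 ?(fmapP G).2.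
Defined.

Definition mutually_inverse (C D : category) (F : functor C D) (G : functor D C) :=
  comp_functor G F = id_functor C /\ comp_functor F G = id_functor D.

Section quotient_category.
Variables (C : category) (r : forall X Y : C, mor X Y -> mor X Y -> Prop).

Record congruence : Prop := Congruence {
  cong_refl : forall X Y (f : mor X Y), r f f;
  cong_sym : forall X Y (f g : mor X Y), r f g -> r g f;
  cong_trans : forall X Y (f g h : mor X Y), r f g -> r g h -> r f h;
  cong_comp : forall X Y Z (g g' : mor Y Z) (f f' : mor X Y),
    r g g' -> r f f' -> r (mor_comp g f) (mor_comp g' f')
}.

Hypothesis rP : congruence.

Section mor.
Variables X Y : C.

Definition cong_rel : rel {classic (mor X Y)} := fun f g => `[< r f g >].

Let cong_rel_refl : reflexive cong_rel.
Proof. by move=> f; apply/asboolP; exact: cong_refl. Qed.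

Let cong_rel_sym : symmetric cong_rel.
Proof. by move=> f g; apply/asboolP/asboolP; exact: cong_sym. Qed.

Let cong_rel_trans : transitive cong_rel.
Proof. by move=> g f h /asboolP fg /asboolP gh; apply/asboolP/(cong_trans rP fg). Qed.

Canonical cong_equiv := EquivRel cong_rel cong_rel_refl cong_rel_sym cong_rel_trans.

Definition quotient_mor : Type := {eq_quot cong_equiv}.

(* The class of f modulo r, see mor_classP. *)
Definition mor_class (f : mor X Y) : quotient_mor := \pi_({eq_quot cong_equiv}) f.

Lemma mor_classP f g : mor_class f = mor_class g <-> r f g.
Proof.
split=> [fg | fg]; first by apply/asboolP; apply/(eqmodP cong_equiv).
by apply/(eqmodP cong_equiv); apply/asboolP.
Qed.

Definition mor_repr (a : quotient_mor) : mor X Y := repr (a : {eq_quot cong_equiv}).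

Lemma mor_reprK a : mor_class (mor_repr a) = a.
Proof. exact: reprK. Qed.

Lemma mor_repr_class f : r (mor_repr (mor_class f)) f.
Proof. by apply/mor_classP; rewrite mor_reprK. Qed.

End mor.

Definition quotient_comp X Y Z (b : quotient_mor Y Z) (a : quotient_mor X Y) :
  quotient_mor X Z := mor_class (mor_comp (mor_repr b) (mor_repr a)).

Lemma quotient_compE X Y Z (g : mor Y Z) (f : mor X Y) :
  quotient_comp (mor_class g) (mor_class f) = mor_class (mor_comp g f).
Proof. by apply/mor_classP/(cong_comp rP); exact: mor_repr_class. Qed.

Definition quotient_category : category.
Proof.
refine (@Category C quotient_mor (fun X => mor_class (mor_id X)) quotient_comp _ _ _).
- by move=> X Y f; rewrite -[f]mor_reprK quotient_compE mor_comp_idl.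
- by move=> X Y f; rewrite -[f]mor_reprK quotient_compE mor_comp_idr.
- move=> W X Y Z h g f.
  by rewrite -[f]mor_reprK -[g]mor_reprK -[h]mor_reprK !quotient_compE mor_compA.
Defined.

End quotient_category.
Arguments mor_class {C r} rP {X Y} f.

Section coarse.
Variable R : realType.

Definition uniformly_discrete (X : metricType R) :=
  exists2 d : R, 0 < d & forall x y : X, x != y -> d <= mdist x y.

Definition bounded_geometry (X : metricType R) :=
  forall r : R, 0 <= r -> exists N : nat, forall x : X,
    ([set y | mdist x y <= r] #<= `I_N)%card.

Record ubg_space := UbgSpace {
  ubg_carrier :> metricType R;
  ubg_discrete : uniformly_discrete ubg_carrier;
  ubg_geometry : bounded_geometry ubg_carrier
}.

Definition uniformly_expansive (X Y : metricType R) (f : X -> Y) :=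
  forall r : R, 0 < r -> exists2 s : R, 0 < s &
    forall x1 x2, mdist x1 x2 <= r -> mdist (f x1) (f x2) <= s.

Definition close_maps (X Y : metricType R) (f g : X -> Y) :=
  exists2 c : R, 0 < c & forall x, mdist (f x) (g x) <= c.

Definition coarsely_inverse (X Y : metricType R) (f : X -> Y) (g : Y -> X) :=
  close_maps (f \o g) id /\ close_maps (g \o f) id.

Definition is_coarse_equivalence (X Y : metricType R) (f : X -> Y) :=
  uniformly_expansive f /\
  exists g : Y -> X, uniformly_expansive g /\ coarsely_inverse f g.

Record coarse_equivalence (X Y : metricType R) := CoarseEquivalence {
  coarse_fun :> X -> Y;
  coarse_funP : is_coarse_equivalence coarse_fun
}.

Lemma coarse_equivalence_eq (X Y : metricType R) (f g : coarse_equivalence X Y) :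
  f = g :> (X -> Y) -> f = g.
Proof.
case: f g => [f fP] [g gP] /= fg; case: _ / fg gP => gP.
by congr CoarseEquivalence; exact: Prop_irrelevance.
Qed.

Lemma close_maps_refl (X Y : metricType R) (f : X -> Y) : close_maps f f.
Proof. by exists 1 => // x; rewrite mdistxx. Qed.

Lemma close_maps_sym (X Y : metricType R) (f g : X -> Y) : close_maps f g -> close_maps g f.
Proof. by move=> [c c0 fg]; exists c => // x; rewrite metric_sym. Qed.

Lemma close_maps_trans (X Y : metricType R) (f g h : X -> Y) :
  close_maps f g -> close_maps g h -> close_maps f h.
Proof.
move=> [c c0 fg] [d d0 gh]; exists (c + d); first exact: addr_gt0.
by move=> x; apply: le_trans (metric_triangle _ (g x) _) _; exact: lerD.
Qed.

Lemma close_maps_comp (X Y Z : metricType R) (g g' : Y -> Z) (f f' : X -> Y) :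
  uniformly_expansive g -> close_maps g g' -> close_maps f f' -> close_maps (g \o f) (g' \o f').
Proof.
move=> gexp [c c0 gg'] [d d0 ff']; have [s s0 gs] := gexp _ d0.
exists (s + c); first exact: addr_gt0.
move=> x /=; apply: le_trans (metric_triangle _ (g (f' x)) _) _.
by apply: lerD; [exact: gs | exact: gg'].
Qed.

Lemma uniformly_expansive_comp (X Y Z : metricType R) (g : Y -> Z) (f : X -> Y) :
  uniformly_expansive g -> uniformly_expansive f -> uniformly_expansive (g \o f).
Proof.
move=> gexp fexp r r0; have [s s0 fs] := fexp _ r0; have [t t0 gt] := gexp _ s0.
by exists t => // x1 x2 x12; apply/gt/fs.
Qed.

Lemma is_coarse_equivalence_id (X : metricType R) :
  is_coarse_equivalence (id : X -> X).
Proof.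
have idexp : uniformly_expansive (id : X -> X) by move=> r r0; exists r.
by split=> //; exists id; do !split=> //; exact: close_maps_refl.
Qed.

Lemma is_coarse_equivalence_comp (X Y Z : metricType R) (g : Y -> Z) (f : X -> Y) :
  is_coarse_equivalence g -> is_coarse_equivalence f -> is_coarse_equivalence (g \o f).
Proof.
move=> [gexp [g' [g'exp [gg' g'g]]]] [fexp [f' [f'exp [ff' f'f]]]].
split; first exact: uniformly_expansive_comp.
exists (f' \o g'); split; first exact: uniformly_expansive_comp.
split.
- apply: (@close_maps_trans _ _ _ (g \o id \o g')) => //.
  apply: (@close_maps_comp _ _ _ (g \o (f \o f')) (g \o id) g' g').
  + by apply: uniformly_expansive_comp => //; exact: uniformly_expansive_comp.
  + exact: (@close_maps_comp _ _ _ g g (f \o f') id gexp (close_maps_refl g) ff').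
  + exact: close_maps_refl.
- apply: (@close_maps_trans _ _ _ (f' \o id \o f)) => //.
  apply: (@close_maps_comp _ _ _ (f' \o (g' \o g)) (f' \o id) f f).
  + by apply: uniformly_expansive_comp => //; exact: uniformly_expansive_comp.
  + exact: (@close_maps_comp _ _ _ f' f' (g' \o g) id f'exp (close_maps_refl f') g'g).
  + exact: close_maps_refl.
Qed.

Definition coarse_category0 : category.
Proof.
refine (@Category ubg_space coarse_equivalence
  (fun X => CoarseEquivalence (is_coarse_equivalence_id X))
  (fun X Y Z g f => CoarseEquivalence
    (is_coarse_equivalence_comp (coarse_funP g) (coarse_funP f))) _ _ _).
- by move=> X Y f; exact: coarse_equivalence_eq.
- by move=> X Y f; exact: coarse_equivalence_eq.
- by move=> W X Y Z h g f; exact: coarse_equivalence_eq.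
Defined.

Definition close_coarse0 (X Y : coarse_category0)
    (f g : @mor coarse_category0 X Y) := close_maps f g.

Lemma close_coarse_congruence : congruence close_coarse0.
Proof.
split=> [X Y f|X Y f g|X Y f g h|X Y Z g g' f f'].
- exact: close_maps_refl.
- exact: close_maps_sym.
- exact: close_maps_trans.
- exact: close_maps_comp (coarse_funP g).1.
Qed.

Definition coarse_category : category := quotient_category close_coarse_congruence.

End coarse.

Section roe.
Variables (R : realType) (H : hilbertType R[i]).

(* The matrix coefficient T_yx. *)
Definition coeff (X Y : choiceType) (T : l2 X H -> l2 Y H) (y : Y) (x : X) : H -> H :=
  fun v => T (l2_delta x v) y.

Definition finite_propagation (X : metricType R) (T : l2 X H -> l2 X H) :=
  exists2 s : R, 0 < s & forall x y, s <= mdist x y -> coeff T x y = cst 0.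

(* C[X], as a set of operators on l2 X H. *)
Definition algebraic_roe (X : metricType R) : set (l2 X H -> l2 X H) :=
  [set T | [/\ bounded_operator T, finite_propagation T &
               forall x y, compact_operator (coeff T x y)]].

Record roe_iso (X Y : metricType R) := RoeIso {
  roe_unitary :> unitary (l2 X H) (l2 Y H);
  roe_isoP : star_isomorphism (algebraic_roe (X := X)) (algebraic_roe (X := Y))
               (unitary_conj roe_unitary)
}.

Lemma roe_iso_eq (X Y : metricType R) (U V : roe_iso X Y) :
  U = V :> (l2 X H -> l2 Y H) -> U = V.
Proof.
case: U V => [U UP] [V VP] /= /unitary_eq UV; case: _ / UV VP => VP.
by congr RoeIso; exact: Prop_irrelevance.
Qed.

Definition roe_category0 : category.
Proof.
refine (@Category (ubg_space R) roe_iso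
  (fun X => @RoeIso X X (unitary_id (l2 X H)) (star_isomorphism_id _))
  (fun X Y Z V U => @RoeIso X Z (unitary_comp V U)
     (star_isomorphism_comp (roe_isoP U) (roe_isoP V))) _ _ _).
- by move=> X Y U; exact: roe_iso_eq.
- by move=> X Y U; exact: roe_iso_eq.
- by move=> W X Y Z U V V'; exact: roe_iso_eq.
Defined.

(* U^*V has finite propagation. *)
Definition close_unitary (X Y : metricType R) (U V : unitary (l2 X H) (l2 Y H)) :=
  finite_propagation (unitary_adj U \o V).

Definition close_roe0 (X Y : roe_category0) (U V : @mor roe_category0 X Y) :=
  close_unitary U V.

(* The quotient makes sense once closeness is known to be compatible with the
   composition of roe_category0; for coarse equivalences this is
   close_coarse_congruence. *)
Definition roe_category (closeP : congruence close_roe0) : category :=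
  quotient_category closeP.

Definition covers (X Y : metricType R) (U : unitary (l2 X H) (l2 Y H)) (f : X -> Y) :=
  exists2 c : R, 0 <= c &
    forall x y, coeff U y x <> cst 0 -> mdist (f x) y <= c.

End roe.

(* Main.v *)
From HB Require Import structures.
Require Import Defs.
From mathcomp Require Import all_boot all_order all_algebra finmap.
From mathcomp Require Import complex ring lra.
From mathcomp Require Import all_classical all_reals topology normedtype.
From mathcomp Require Import summability.

(** Closeness classes of unitaries correspond to closeness classes of coarse
    equivalences through the covering relation. That relation is compatible with
    identities ([covers_id]) and composition ([covers_comp]), and if U covers f and V
    covers g then U and V are close exactly when f and g are ([close_coversP]): a
    nonzero coefficient of a composition factors through an intermediate point
    ([coeff_comp]), so supports can be chased by the triangle inequality. Once every
    unitary of the Roe category covers a coarse equivalence and conversely, everything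
    else, including that closeness of unitaries is a congruence, is transported along
    the covering relation.

    A unitary U that implements an isomorphism of algebraic Roe algebras covers a
    coarse equivalence ([roe_iso_covers]). The point is the uniform estimate
    [roe_expansive]: if x1 and x2 stay within distance r of each other and U has
    nonzero coefficients at (y1, x1) and (y2, x2), then y1 and y2 stay within some
    distance s that depends only on r. Otherwise a sequence of bad quadruples gives
    rank one operators of propagation at most r whose conjugates under U have nonzero
    coefficients arbitrarily far from the diagonal. A gliding hump ([gliding_hump])
    picks summable weights such that the weighted sum T still has all these
    coefficients nonzero after conjugation. The series converges in norm, so T lies in
    the algebraic Roe algebra, while its conjugate has infinite propagation. Given the
    estimate for U and its adjoint, f sends x to any y at which U has a nonzero
    coefficient.

    A coarse equivalence f is covered by such a unitary ([coarse_covered],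
    [covers_roe_iso]). The space H has an orthonormal basis indexed by the natural
    numbers, so it suffices to find a bijection from X * nat to Y * nat whose first
    component stays within bounded distance of f; over each point of the image of f the
    two sides are countably infinite. By bounded geometry, each coefficient of a conjugate of T is a
    finite sum of compact operators. *)

Set Implicit Arguments.
Unset Strict Implicit.
Unset Printing Implicit Defensive.

Import Order.TTheory GRing.Theory Num.Theory numFieldNormedType.Exports.
Local Open Scope classical_set_scope.
Local Open Scope ring_scope.

#[local] Existing Instance totally_filter.

(** * Inner products, adjoints and the space of square summable families *)

Lemma ler_sqrn (K : numDomainType) (x y : K) :
  0 <= x -> 0 <= y -> (x ^+ 2 <= y ^+ 2) = (x <= y).
Proof. by move=> x0 y0; rewrite ler_pXn2r. Qed.

Section inner_theory.
Variables (K : numClosedFieldType) (E : innerProductModType K).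
Implicit Types (u v w : E) (a : K).

Lemma innerC u v : inner u v = (inner v u)^*.
Proof. by rewrite hermC expr0 mul1r. Qed.

Lemma innerDl u v w : inner (u + v) w = inner u w + inner v w.
Proof. exact: linearDl. Qed.

Lemma innerZl a u v : inner (a *: u) v = a * inner u v.
Proof. exact: (linearZl_LR (@inner K E)). Qed.

Lemma innerBl u v w : inner (u - v) w = inner u w - inner v w.
Proof. exact: linearBl. Qed.

Lemma inner0l u : inner 0 u = 0.
Proof. exact: linear0l. Qed.

Lemma innerDr u v w : inner w (u + v) = inner w u + inner w v.
Proof. exact: linearDr. Qed.

Lemma innerZr a u v : inner u (a *: v) = a^* * inner u v.
Proof. by rewrite innerC innerZl rmorphM/= [in RHS]innerC. Qed.

Lemma innerBr u v w : inner w (u - v) = inner w u - inner w v.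
Proof. exact: linearBr. Qed.

Lemma inner0r u : inner u 0 = 0.
Proof. exact: linear0r. Qed.

Lemma inner_suml I (r : seq I) (P : pred I) (F : I -> E) u :
  inner (\sum_(i <- r | P i) F i) u = \sum_(i <- r | P i) inner (F i) u.
Proof.
apply: (big_morph (fun v => inner v u)); first by move=> *; exact: innerDl.
exact: inner0l.
Qed.

Lemma inner_sumr I (r : seq I) (P : pred I) (F : I -> E) u :
  inner u (\sum_(i <- r | P i) F i) = \sum_(i <- r | P i) inner u (F i).
Proof.
apply: (big_morph (fun v => inner u v)); first by move=> *; exact: innerDr.
exact: inner0r.
Qed.

Lemma norm_inner u v : `|inner u v| <= `|u| * `|v|.
Proof.
rewrite -(ler_pXn2r (n := 2)) ?nnegrE ?mulr_ge0// exprMn -!inner_norm.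
exact: dot_cauchy_schwarz.
Qed.

Lemma inner_eq0P u : reflect (u = 0) (inner u u == 0).
Proof. by rewrite inner_norm expf_eq0/= normr_eq0; exact: eqP. Qed.

Lemma inner_ext u v : (forall w, inner u w = inner v w) -> u = v.
Proof.
by move=> uv; apply/subr0_eq/inner_eq0P; rewrite innerBl uv subrr.
Qed.

End inner_theory.

Section adjoint_theory.
Variables (K : numClosedFieldType) (E F : innerProductModType K).

Lemma adjointC (T : E -> F) (S : F -> E) : adjoint T S -> adjoint S T.
Proof. by move=> TS u v; rewrite innerC -TS -innerC. Qed.

Lemma adjoint_linear (T : E -> F) (S : F -> E) : adjoint T S -> linear T.
Proof.
move=> TS a u v; apply: inner_ext => w.
by rewrite TS !innerDl !innerZl !TS.
Qed.

(** Polarization: expanding the norm of a *: u + v for enough scalars a recovers the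
    inner product. *)
Lemma isometry_inner (T : E -> F) : linear T -> (forall u, `|T u| = `|u|) ->
  forall u v, inner (T u) (T v) = inner u v.
Proof.
move=> Tlin Tiso u v.
have T2 w : inner (T w) (T w) = inner w w by rewrite !inner_norm Tiso.
have TD a w z : T (a *: w + z) = a *: T w + T z by rewrite Tlin.
have h (a : K) : a * inner (T u) (T v) + a^* * inner (T v) (T u) =
                 a * inner u v + a^* * inner v u.
  have := T2 (a *: u + v); rewrite TD !(innerDl, innerDr, innerZl, innerZr) !T2.
  set p := inner (T u) _; set q := inner (T v) _; set p' := inner u v; set q' := inner v u.
  move=> e.
  have -> : a * p + a^* * q =
     a * (a^* * inner u u) + a * p + (a^* * q + inner v v)
     - (a * (a^* * inner u u)) - inner v v by ring.
  rewrite e; ring.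
(* Taking the scalar to be 1 and 'i isolates the sum and the difference of the two
   cross terms. *)
have := h 1; rewrite conjC1 !mul1r => h1.
have := h 'i; rewrite conjCi !mulNr -!mulrBr => /(mulfI (neq0Ci _)) h2.
apply: (mulfI (x := 2)); first by rewrite pnatr_eq0.
have -> : 2 * inner (T u) (T v) = (inner (T u) (T v) + inner (T v) (T u))
   + (inner (T u) (T v) - inner (T v) (T u)) by ring.
by rewrite h1 h2; ring.
Qed.

End adjoint_theory.

Section unitary_theory.
Variables (K : numClosedFieldType) (E F : innerProductModType K).

Lemma unitary_adjoint (U : unitary E F) : adjoint U (unitary_adj U).
Proof. exact: unitary_adjP. Qed.

Lemma unitary_adj_adjoint (U : unitary E F) : adjoint (unitary_adj U) U.
Proof. exact: adjointC (unitary_adjoint U). Qed.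

Lemma unitary_linear_adj (U : unitary E F) : linear (unitary_adj U).
Proof. exact: adjoint_linear (unitary_adj_adjoint U). Qed.

Lemma unitary_inner (U : unitary E F) u v : inner (U u) (U v) = inner u v.
Proof. by rewrite unitary_adjP unitary_funK. Qed.

Lemma unitary_norm (U : unitary E F) u : `|U u| = `|u|.
Proof.
apply/eqP; rewrite -(eqrXn2 (n := 2))// -!inner_norm.
by rewrite unitary_inner.
Qed.

Definition unitary_inv (U : unitary E F) : unitary F E :=
  Unitary (@unitary_linear_adj U) (unitary_adj_adjoint U)
    (@unitary_adjK _ _ _ U) (@unitary_funK _ _ _ U).

End unitary_theory.

Section linear_theory.
Variables (K : numDomainType) (E F : lmodType K) (T : E -> F).
Hypothesis Tlin : linear T.

Lemma linear_fun0 : T 0 = 0.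
Proof. by have := Tlin (-1) 0 0; rewrite scaler0 addr0 scaleN1r addNr. Qed.

Lemma linear_funD u v : T (u + v) = T u + T v.
Proof. by have := Tlin 1 u v; rewrite !scale1r. Qed.

Lemma linear_funZ a u : T (a *: u) = a *: T u.
Proof. by have := Tlin a u 0; rewrite addr0 linear_fun0 addr0. Qed.

Lemma linear_funB u v : T (u - v) = T u - T v.
Proof. by rewrite addrC -scaleN1r Tlin scaleN1r addrC. Qed.

Lemma linear_fun_sum I (r : seq I) (P : pred I) (f : I -> E) :
  T (\sum_(i <- r | P i) f i) = \sum_(i <- r | P i) T (f i).
Proof. exact: (big_morph T linear_funD linear_fun0). Qed.

End linear_theory.

Section l2_pointwise.
Variables (K : numClosedFieldType) (X : choiceType) (H : normedModType K).
Implicit Types (f g : l2 X H) (x : X) (v w : H).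

Lemma l2_ext f g : f =1 g -> f = g.
Proof. by move=> fg; apply/val_inj/funext. Qed.

Lemma l2D f g x : (f + g) x = f x + g x. Proof. by []. Qed.
Lemma l2B f g x : (f - g) x = f x - g x. Proof. by []. Qed.
Lemma l2Z (a : K) f x : (a *: f) x = a *: f x. Proof. by []. Qed.
Lemma l20 x : (0 : l2 X H) x = 0. Proof. by []. Qed.

Lemma l2_sum I (r : seq I) (P : pred I) (F : I -> l2 X H) x :
  (\sum_(i <- r | P i) F i) x = \sum_(i <- r | P i) F i x.
Proof. exact: (big_morph (fun f : l2 X H => f x) (fun f g => l2D f g x) (l20 x)). Qed.

Lemma l2_deltaE x v y : l2_delta x v y = if y == x then v else 0.
Proof. by []. Qed.

Lemma l2_delta_linear x : linear (@l2_delta K X H x).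
Proof.
move=> a v w; apply: l2_ext => y; rewrite l2D l2Z !l2_deltaE.
by case: ifP => // _; rewrite scaler0 addr0.
Qed.

Lemma l2_finite_support f (J : {fset X}) : (forall x, f x != 0 -> x \in J) ->
  f = \sum_(x <- J) l2_delta x (f x).
Proof.
move=> fJ; apply: l2_ext => y; rewrite l2_sum.
have [yJ|yJ] := boolP (y \in J).
  rewrite (big_fsetD1 y)//= eqxx big_seq big1 ?addr0// => x.
  by rewrite !inE eq_sym => /andP[/negPf -> _].
rewrite big_seq big1 => [|x xJ].
  by apply/eqP; apply: contraNT yJ; exact: fJ.
by rewrite l2_deltaE; case: eqP xJ yJ => // -> ->.
Qed.

End l2_pointwise.

Section l2_theory.
Variables (R : realType) (X : choiceType) (H : innerProductModType R[i]).
Implicit Types (f g : l2 X H) (x : X) (v : H).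

Lemma l2_innerE f g : inner f g = l2_inner f g.
Proof. by []. Qed.

Lemma inner_l2_delta x v f : inner (l2_delta x v) f = inner v (f x).
Proof.
rewrite l2_innerE; apply: l2_inner_unique; apply: cvg_near_cst.
exists [fset x]%fset => // J /=; rewrite fsub1set => xJ; rewrite partial_sumE.
rewrite (big_fsetD1 x)//= eqxx big_seq big1 ?addr0// => y.
by rewrite !inE => /andP[/negPf -> _]; rewrite inner0l.
Qed.

Lemma inner_l2_delta_r x v f : inner f (l2_delta x v) = inner (f x) v.
Proof. by rewrite innerC inner_l2_delta -innerC. Qed.

Lemma norm_l2_delta x v : `|l2_delta x v| = `|v|.
Proof.
apply/eqP; rewrite -(eqrXn2 (n := 2))// -!inner_norm inner_l2_delta l2_deltaE.
by rewrite eqxx.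
Qed.

(** All terms of the sum that defines the inner product would vanish otherwise. *)
Lemma l2_inner_neq0 f g : inner f g != 0 -> exists2 x, f x != 0 & g x != 0.
Proof.
move=> /eqP fg0; apply: contrapT => /forall2NP fg; apply: fg0.
rewrite l2_innerE; apply: l2_inner_unique; apply: cvg_near_cst.
near=> J; rewrite partial_sumE big1// => x _.
by have [/negP/negPn/eqP->|/negP/negPn/eqP->] := fg x; rewrite ?inner0l ?inner0r.
Unshelve. all: by end_near. Qed.

Lemma l2_norm_ge f (J : {fset X}) : \sum_(x <- J) `|f x| ^+ 2 <= `|f| ^+ 2.
Proof.
(* The truncation of f to J, which satisfies <fJ, f> = <fJ, fJ>. *)
pose fJ := \sum_(x <- J) l2_delta x (f x).
have fJ2 : inner fJ f = `|fJ| ^+ 2.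
  rewrite -inner_norm !inner_suml; rewrite big_seq [RHS]big_seq.
  apply: eq_bigr => x xJ; rewrite !inner_l2_delta; congr (inner _ _); rewrite l2_sum.
  rewrite (big_fsetD1 x)//= eqxx big_seq big1 ?addr0// => y.
  by rewrite !inE eq_sym => /andP[/negPf -> _].
have -> : \sum_(x <- J) `|f x| ^+ 2 = `|fJ| ^+ 2.
  rewrite -fJ2 inner_suml; apply: eq_bigr => x _.
  by rewrite inner_l2_delta inner_norm.
rewrite ler_sqrn//; have [->|fJ0] := eqVneq fJ 0; first by rewrite normr0.
rewrite -(ler_pM2l (x := `|fJ|)) ?normr_gt0// -expr2 -fJ2.
by rewrite (le_trans _ (norm_inner _ _))// fJ2 normrX normr_id.
Qed.

Lemma l2_norm_le f (M : R[i]) :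
  (forall J : {fset X}, \sum_(x <- J) `|f x| ^+ 2 <= M) -> `|f| ^+ 2 <= M.
Proof.
move=> fM; apply/ler_addgt0Pl => e e0.
have /cvgrPdist_le/(_ _ e0)[J _ /(_ J (fsubset_refl J))] := @cvg_l2_inner R X H f f.
rewrite -l2_innerE inner_norm partial_sumE.
under eq_bigr do rewrite inner_norm.
move=> h.
rewrite -[leLHS](subrK (\sum_(x <- J) `|f x| ^+ 2)) lerD//.
apply: le_trans h; apply/real_ler_norm/realB; apply/ger0_real; rewrite ?exprn_ge0//.
by rewrite sumr_ge0// => x _; exact: exprn_ge0.
Qed.

Lemma l2_norm_eval f x : `|f x| <= `|f|.
Proof.
rewrite -ler_sqrn//; apply: le_trans (l2_norm_ge f [fset x]%fset).
by rewrite big_seq_fset1.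
Qed.

End l2_theory.

(** * Matrix coefficients and coverings *)

Section coefficients.
Variables (R : realType) (H : hilbertType R[i]).

Lemma coeff_neq0P (X Y : choiceType) (T : l2 X H -> l2 Y H) y x :
  coeff T y x <> cst 0 <-> exists v, T (l2_delta x v) y != 0.
Proof.
split=> [Tyx|[v Tv0] Tyx].
  apply: contrapT => /forallNP Tv; apply: Tyx; apply/funext => v.
  by have /negP/negPn/eqP := Tv v.
by move: Tv0; rewrite -[T _ _]/(coeff T y x v) Tyx eqxx.
Qed.

Lemma coeff_adjoint (X Y : choiceType) (S : l2 X H -> l2 Y H) S' y x :
  adjoint S S' -> coeff S y x <> cst 0 -> coeff S' x y <> cst 0.
Proof.
move=> SS' /coeff_neq0P[v Sv]; apply/coeff_neq0P; exists (S (l2_delta x v) y).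
apply: contra_neq Sv => S'0; apply/inner_eq0P/eqP.
by rewrite -inner_l2_delta_r SS' inner_l2_delta S'0 inner0r.
Qed.

(** A nonzero value of S (T (l2_delta x v)) at z is a nonzero inner product of
    T (l2_delta x v) with the image of a delta function at z under the adjoint of S; the
    two have a common support point y. *)
Lemma coeff_comp (X Y Z : choiceType) (T : l2 X H -> l2 Y H)
    (S : l2 Y H -> l2 Z H) S' z x :
  adjoint S S' -> coeff (S \o T) z x <> cst 0 ->
  exists2 y, coeff T y x <> cst 0 & coeff S z y <> cst 0.
Proof.
move=> SS' /coeff_neq0P[v /= Sv].
have : inner (T (l2_delta x v)) (S' (l2_delta z (S (T (l2_delta x v)) z))) != 0.
  by rewrite -SS' inner_l2_delta_r inner_norm expf_neq0// normr_eq0.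
move=> /l2_inner_neq0[y Ty S'y]; exists y; first by apply/coeff_neq0P; exists v.
apply: (coeff_adjoint (adjointC SS')); apply/coeff_neq0P.
by eexists; exact: S'y.
Qed.

End coefficients.

Section coarse_bounds.
Variables (R : realType) (X Y : metricType R).
Implicit Types f g : X -> Y.

Lemma close_mapsP f g :
  close_maps f g <-> exists c, forall x, mdist (f x) (g x) <= c.
Proof.
split=> [[c _ fg]|[c fg]]; first by exists c.
exists (`|c| + 1); first by rewrite ltr_wpDl.
by move=> x; apply: le_trans (fg x) _; rewrite (le_trans (ler_norm c))// lerDl.
Qed.

Lemma uniformly_expansiveP f : uniformly_expansive f <->
  forall r, exists s, forall x1 x2, mdist x1 x2 <= r -> mdist (f x1) (f x2) <= s.
Proof.
split=> fexp r.
  have [|s _ fs] := fexp (`|r| + 1); first by rewrite ltr_wpDl.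
  exists s => x1 x2 x12; apply: fs; apply: le_trans x12 _.
  by rewrite (le_trans (ler_norm r))// lerDl.
move=> r0; have [s fs] := fexp r; exists (`|s| + 1); first by rewrite ltr_wpDl.
move=> x1 x2 x12; apply: le_trans (fs _ _ x12) _.
by rewrite (le_trans (ler_norm s))// lerDl.
Qed.

End coarse_bounds.

(** A coarse inverse carries close values of f back to close points. *)
Lemma coarse_equivalence_proper (R : realType) (X Y : metricType R) (f : X -> Y) :
  is_coarse_equivalence f ->
  forall r, exists s, forall x1 x2, mdist (f x1) (f x2) <= r -> mdist x1 x2 <= s.
Proof.
move=> [_ [g [/uniformly_expansiveP gexp [_ [c _ gf]]]]] r.
have [s gs] := gexp r; exists (c + s + c) => x1 x2 /gs gfs.
apply: le_trans (metric_triangle _ (g (f x2)) _) _; apply: lerD; last exact: gf.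
apply: le_trans (metric_triangle _ (g (f x1)) _) _; apply: lerD => //.
by rewrite metric_sym; exact: gf.
Qed.

(** Finite propagation as an upper bound on the support, the form in which supports are
    composed. *)
Lemma finite_propagationP (R : realType) (H : hilbertType R[i]) (X : metricType R)
    (T : l2 X H -> l2 X H) :
  finite_propagation T <->
  exists s, forall x y, coeff T x y <> cst 0 -> mdist x y <= s.
Proof.
split=> [[s _ Ts]|[s Ts]].
  by exists s => x y; apply: contra_notP => /negP; rewrite -ltNge => /ltW/Ts.
exists (`|s| + 1); first by rewrite ltr_wpDl.
move=> x y xy; apply: contrapT => /Ts; apply/negP; rewrite -ltNge.
by apply: lt_le_trans xy; rewrite ltr_pwDr// ler_norm.
Qed.

Section covering.
Variables (R : realType) (H : hilbertType R[i]).

Lemma coversP (X Y : metricType R) (U : unitary (l2 X H) (l2 Y H)) (f : X -> Y) :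
  covers U f <->
  exists c, forall x y, coeff U y x <> cst 0 -> mdist (f x) y <= c.
Proof.
split=> [[c _ fc]|[c fc]]; first by exists c.
by exists `|c| => // x y /fc/le_trans; apply; exact: ler_norm.
Qed.

Lemma covers_id (X : metricType R) : covers (unitary_id (l2 X H)) id.
Proof.
exists 0 => // x y /coeff_neq0P[v] /=.
by case: (eqVneq y x) => [->|]; rewrite ?mdistxx ?eqxx.
Qed.

Lemma covers_comp (X Y Z : metricType R) (U : unitary (l2 X H) (l2 Y H))
    (V : unitary (l2 Y H) (l2 Z H)) (f : X -> Y) (g : Y -> Z) :
  uniformly_expansive g -> covers U f -> covers V g ->
  covers (unitary_comp V U) (g \o f).
Proof.
move=> /uniformly_expansiveP gexp [c _ Uf] [d _ Vg]; have [s gs] := gexp c.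
apply/coversP; exists (s + d) => x z.
move=> /(coeff_comp (unitary_adjoint V))[y /Uf/gs fxy /Vg gyz].
by apply: le_trans (metric_triangle _ (g y) _) _; exact: lerD.
Qed.

(** The support of the adjoint is the transposed support, and f x close to y means x
    close to g y. *)
Lemma covers_inv (X Y : metricType R) (U : unitary (l2 X H) (l2 Y H))
    (f : X -> Y) (g : Y -> X) :
  uniformly_expansive g -> close_maps (g \o f) id ->
  covers U f -> covers (unitary_inv U) g.
Proof.
move=> /uniformly_expansiveP gexp [d _ gf] [c _ Uf]; have [s gs] := gexp c.
apply/coversP; exists (s + d) => y x.
move=> /(coeff_adjoint (unitary_adj_adjoint U))/Uf/gs; rewrite metric_sym => gyx.
by apply: le_trans (metric_triangle _ (g (f x)) _) _; rewrite lerD//; exact: gf.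
Qed.

Lemma unitary_coeff_ex (X Y : metricType R) (U : unitary (l2 X H) (l2 Y H)) (v : H) (x : X) :
  v != 0 -> exists y, coeff U y x <> cst 0.
Proof.
move=> v0; apply: contrapT => /forallNP Ux; move/negP: v0; apply.
rewrite -normr_eq0 -(norm_l2_delta x) -(unitary_norm U) normr_eq0; apply/eqP.
apply: l2_ext => y; apply: contrapT => /eqP Uy; apply: (Ux y).
by apply/coeff_neq0P; exists v.
Qed.

(** Writing V as U composed with U^* V, a nonzero coefficient of V at (y, x) passes
    through some x' near x with a nonzero coefficient of U at (y, x'), so that g x, y,
    f x' and f x are successively close. *)
Lemma covers_close_maps (X Y : metricType R) (U V : unitary (l2 X H) (l2 Y H))
    (f g : X -> Y) (v : H) : v != 0 ->
  uniformly_expansive f -> covers U f -> covers V g ->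
  close_unitary U V -> close_maps f g.
Proof.
move=> v0 /uniformly_expansiveP fexp [c _ Uf] [d _ Vg] /finite_propagationP[s UV].
have [t ft] := fexp s; apply/close_mapsP; exists (t + c + d) => x.
have [y Vyx] := unitary_coeff_ex V x v0.
have : coeff (U \o (unitary_adj U \o V)) y x <> cst 0.
  by rewrite (_ : U \o _ = V)//; apply/funext => w /=; rewrite unitary_adjK.
move=> /(coeff_comp (unitary_adjoint U))[x' /UV /ft x'x /Uf x'y].
rewrite metric_sym in x'x.
apply: le_trans (metric_triangle _ y _) _; apply: lerD; last first.
  by rewrite metric_sym; exact: Vg.
by apply: le_trans (metric_triangle _ (f x') _) _; rewrite lerD// metric_sym.
Qed.

(** A nonzero coefficient of U^* V at (x', x) passes through some y close to both f x'
    and g x, and f is proper. *)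
Lemma covers_close_unitary (X Y : metricType R) (U V : unitary (l2 X H) (l2 Y H))
    (f g : X -> Y) : is_coarse_equivalence f ->
  covers U f -> covers V g -> close_maps f g -> close_unitary U V.
Proof.
move=> /coarse_equivalence_proper fprop [c _ Uf] [d _ Vg] [e _ fg].
have [s fs] := fprop (c + (d + e)); apply/finite_propagationP; exists s => x' x.
move=> /(coeff_comp (unitary_adj_adjoint U))[y /Vg gxy].
move=> /(coeff_adjoint (unitary_adj_adjoint U))/Uf fx'y; apply: fs.
apply: le_trans (metric_triangle _ y _) _; apply: lerD => //.
apply: le_trans (metric_triangle _ (g x) _) _; rewrite metric_sym in gxy.
by apply: lerD => //; rewrite metric_sym.
Qed.

Lemma infinite_dimensional_neq0 (K : numFieldType) (V : lmodType K) :
  infinite_dimensional V -> exists v : V, v != 0.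
Proof.
move=> Vinf; apply: contrapT => /forallNP V0; apply: Vinf.
exists 0%N, (fun=> 0) => v; exists (fun=> 0); rewrite big_ord0.
by have /negP/negPn/eqP := V0 v.
Qed.

End covering.

(** * Completeness of the space of square summable families *)

(** The values of the norm are only partially ordered, so the bound is passed to the limit
    up to an arbitrarily small error. *)
Lemma norm_cvg_le (K : numFieldType) (V : normedModType K) (T : Type)
    (F : set_system T) {FF : ProperFilter F} (f : T -> V) (l a : V) (M : K) :
  f @ F --> l -> (\forall t \near F, `|f t - a| <= M) -> `|l - a| <= M.
Proof.
move=> /cvgrPdist_le fl fM; apply/ler_addgt0Pr => e e0.
have [t [ft ltf]] := filter_ex (filterI fM (fl _ e0)).
by apply: le_trans (ler_distD (f t) _ _) _; rewrite addrC; exact: lerD.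
Qed.

Section l2_complete.
Variables (R : realType) (X : choiceType) (H : hilbertType R[i]).

(** The limit is taken pointwise; bounds on the finite sums of squares pass to it and
    give both its square summability and convergence in norm. *)
Lemma l2_cauchy_cvg (F : set_system (l2 X H)) :
  ProperFilter F -> cauchy F -> cvg F.
Proof.
move=> FF /cauchyP Fc.
have Fnear e : 0 < e -> exists f0, \forall f \near F, `|f0 - f| <= e.
  by move=> /Fc[f0]; rewrite -ball_normE => Ff0; exists f0; apply: filterS Ff0 => f /ltW.
have Fx x : cvg ((fun f : l2 X H => f x) @ F).
  apply: cauchy_cvg; apply: cauchy_exP => e /Fc[f0]; rewrite -ball_normE /= => Ff0.
  exists (f0 x); rewrite -ball_normE /nbhs /=; apply: filterS Ff0 => f /=.
  by apply: le_lt_trans; rewrite -l2B; exact: l2_norm_eval.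
pose g x := lim ((fun f : l2 X H => f x) @ F).
have Jle f0 e (J : {fset X}) : 0 <= e -> (\forall f \near F, `|f0 - f| <= e) ->
    \sum_(x <- J) `|f0 x - g x| ^+ 2 <= e ^+ 2.
  move=> e0 f0e; apply/ler_addgt0Pl => d d0.
  pose h f : R[i]^o := \sum_(x <- J) `|f0 x - f x| ^+ 2.
  have hg : h f @[f --> F] --> (\sum_(x <- J) `|f0 x - g x| ^+ 2 : R[i]^o).
    rewrite /h; elim: (J : seq X) => [|x s IHs].
      under eq_fun do rewrite big_nil.
      by rewrite big_nil; exact: cvg_cst.
    under eq_fun do rewrite big_cons.
    rewrite big_cons; apply: cvgD; last exact: IHs.
    have fx : `|f0 x - f x| @[f --> F] --> (`|f0 x - g x| : R[i]^o).
      by apply: cvg_norm; apply: cvgB => //; [exact: cvg_cst | exact: Fx].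
    by rewrite expr2; under eq_fun do rewrite expr2; exact: cvgM.
  have /cvgrPdist_le/(_ _ d0) hd := hg.
  have [f [f0f fd]] := filter_ex (filterI f0e hd).
  rewrite -[leLHS](subrK (h f)) lerD//; last first.
    apply: (@le_trans _ _ (`|f0 - f| ^+ 2)); first exact: (l2_norm_ge (f0 - f)).
    by rewrite ler_sqrn.
  apply: le_trans fd; apply/real_ler_norm/realB; apply/ger0_real;
    by rewrite sumr_ge0// => x _; exact: exprn_ge0.
have [f1 f1F] := Fnear 1 ltr01.
have gl2 : g \in @square_summable R[i] X H.
  have f1g : (fun x => f1 x - g x) \in @square_summable R[i] X H.
    by apply/asboolP; exists (1 ^+ 2) => J; exact: Jle.
  rewrite (_ : g = val f1 - (fun x => f1 x - g x)); last first.
    by apply/funext => x; rewrite !fctE subKr.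
  by apply: rpredB => //; exact: valP.
apply/cvg_ex; exists (L2 gl2); apply/cvgrPdist_le => e e0.
have [f0 f0F] := Fnear _ (divr_gt0 e0 (ltr0n _ 2)).
have f0g : `|f0 - L2 gl2| <= e / 2.
  have e2 : 0 <= e / 2 by rewrite divr_ge0// ltW.
  rewrite -ler_sqrn//; apply: l2_norm_le => J; exact: Jle.
apply: filterS f0F => f f0f.
apply: le_trans (ler_distD f0 _ _) _; rewrite (splitr e) distrC.
exact: lerD.
Qed.

HB.instance Definition _ := Uniform_isComplete.Build (l2 X H) l2_cauchy_cvg.

End l2_complete.

(** * Limits of operators and compact operators *)

(** The limit is pointwise; the Cauchy estimates in operator norm become error estimates. *)
Lemma limit_operator (K : numClosedFieldType) (E : normedModType K)
    (F : completeNormedModType K) (S : nat -> E -> F) (eps : nat -> K) :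
  (forall n, linear (S n)) -> (forall n, 0 <= eps n) ->
  (forall e, 0 < e -> exists n, eps n <= e) ->
  (forall n m v, (n <= m)%N -> `|S m v - S n v| <= eps n * `|v|) ->
  exists2 T : E -> F, linear T & forall n v, `|T v - S n v| <= eps n * `|v|.
Proof.
move=> Slin eps0 epse Snm.
have Scvg v : cvg (S n v @[n --> \oo]).
  apply: cauchy_cvg; apply: cauchy_exP => e e0.
  have v1 : 0 < 1 + `|v| by rewrite ltr_pwDl.
  have [n ne] := epse (e / 2 / (1 + `|v|)) (divr_gt0 (divr_gt0 e0 (ltr0n _ 2)) v1).
  exists (S n v); exists n => // m /= nm; rewrite -ball_normE /= distrC.
  apply: le_lt_trans (Snm _ _ _ nm) _; apply: (@le_lt_trans _ _ (e / 2)).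
    rewrite ler_pdivlMr// in ne; apply: le_trans ne.
    by apply: ler_wpM2l => //; rewrite lerDr.
  by rewrite ltr_pdivrMr ?ltr0n// ltr_pMr// ltr1n.
exists (fun v => lim (S n v @[n --> \oo])).
  move=> a u v; apply: (@norm_cvg_unique _ _ (S n (a *: u + v) @[n --> \oo])).
    exact: Scvg.
  rewrite (_ : (fun n => _) = (fun n => a *: S n u + S n v)); last first.
    by apply/funext => n; exact: Slin.
  by apply: cvgD; [apply: cvgZl_tmp; exact: Scvg | exact: Scvg].
move=> n v; apply: (norm_cvg_le (Scvg v)); exists n => // m /= nm; exact: Snm.
Qed.

Section compact_operators.
Variable K : numClosedFieldType.
Implicit Types (E F G : normedModType K).

Lemma bounded_operator_continuous E F (T : E -> F) : bounded_operator T -> continuous T.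
Proof.
move=> [Tlin [M TM]] v; apply/cvgrPdist_le => e e0.
have M1 : 0 < 1 + `|M| by rewrite ltr_pwDl.
near=> w; rewrite -linear_funB//; apply: le_trans (TM _) _.
have [->|vw] := eqVneq (v - w) 0; first by rewrite normr0 mulr0 ltW.
have vw0 : 0 < `|v - w| by rewrite normr_gt0.
have M0 : M \is Num.real.
  apply: ger0_real; have := le_trans (normr_ge0 _) (TM (v - w)).
  by rewrite pmulr_lge0.
have : `|v - w| <= e / (1 + `|M|).
  near: w; apply: cvgr_dist_le; [exact: cvg_id | exact: divr_gt0].
rewrite ler_pdivlMr// mulrC; apply: le_trans; apply: ler_wpM2r => //.
by apply: le_trans (real_ler_norm M0) _; rewrite lerDr.
Unshelve. all: by end_near. Qed.

Lemma bounded_operatorP E F (T : E -> F) : bounded_operator T ->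
  exists2 M : K, 0 < M & forall v, `|T v| <= M * `|v|.
Proof.
move=> [Tlin [M TM]]; exists (1 + `|M|); first by rewrite ltr_pwDl.
move=> v; have [->|v0] := eqVneq v 0.
  by rewrite linear_fun0// !normr0 mulr0.
apply: le_trans (TM v) _; apply: ler_wpM2r => //.
have M0 : 0 <= M.
  have := le_trans (normr_ge0 _) (TM v); by rewrite pmulr_lge0// normr_gt0.
by rewrite ger0_norm// lerDr.
Qed.

Lemma bounded_operator_comp E F G (S : F -> G) (T : E -> F) :
  bounded_operator S -> bounded_operator T -> bounded_operator (S \o T).
Proof.
move=> Sb Tb; have [M M0 SM] := bounded_operatorP Sb.
have [N N0 TN] := bounded_operatorP Tb; split.
  by move=> a u v /=; rewrite Tb.1 Sb.1.
exists (M * N) => v /=; apply: le_trans (SM _) _.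
by rewrite -mulrA ler_pM2l.
Qed.

(** In a Hausdorff space it suffices to map the unit ball into some compact set, which is
    how sums and compositions are handled below. *)
Lemma compact_operatorP E F (T : E -> F) : compact_operator T <->
  bounded_operator T /\ exists2 L, compact L & T @` [set v | `|v| <= 1] `<=` L.
Proof.
split=> [[Tb Tc]|[Tb [L Lc TL]]]; split=> //.
  by exists (closure (T @` [set v | `|v| <= 1])) => //; exact: subset_closure.
rewrite -precompactE; apply: precompact_subset TL _.
by apply: compact_precompact => //; exact: norm_hausdorff.
Qed.

Lemma compact_operator0 E F : compact_operator (fun _ : E => 0 : F).
Proof.
apply/compact_operatorP; split.
  split; first by move=> a u v; rewrite scaler0 addr0.
  by exists 0 => v; rewrite normr0 mul0r.
by exists [set 0]; [exact: compact_set1 | move=> _ [v _ <-]].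
Qed.

Lemma compact_operatorD E F (S T : E -> F) :
  compact_operator S -> compact_operator T -> compact_operator (fun v => S v + T v).
Proof.
move=> [Sb Sc] [Tb Tc]; apply/compact_operatorP; split.
  split=> [a u v|]; first by rewrite Sb.1 Tb.1 scalerDr addrACA.
  have [[_ [M SM]] [_ [N TN]]] := (Sb, Tb).
  exists (M + N) => v; rewrite mulrDl.
  by apply: le_trans (ler_normD _ _) _; exact: lerD.
pose cS := closure (S @` [set v | `|v| <= 1]); pose cT := closure (T @` [set v | `|v| <= 1]).
exists ((fun p : F * F => p.1 + p.2) @` (cS `*` cT)).
  apply: continuous_compact; last exact: compact_setX.
  by apply: continuous_subspaceT => p; exact: add_continuous.
move=> _ [v v1 <-]; exists (S v, T v) => //.
by split; apply: subset_closure; exists v.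
Qed.

Lemma compact_operator_sum E F I (r : seq I) (T : I -> E -> F) :
  (forall i, compact_operator (T i)) ->
  compact_operator (fun v => \sum_(i <- r) T i v).
Proof.
move=> Tc; elim: r => [|i r IHr].
  by under eq_fun do rewrite big_nil; exact: compact_operator0.
by under eq_fun do rewrite big_cons; exact: compact_operatorD.
Qed.

Lemma compact_operator_compl E F G (S : F -> G) (T : E -> F) :
  bounded_operator S -> compact_operator T -> compact_operator (S \o T).
Proof.
move=> Sb [Tb Tc]; apply/compact_operatorP; split; first exact: bounded_operator_comp.
exists (S @` closure (T @` [set v | `|v| <= 1])).
  apply: continuous_compact => //; apply: continuous_subspaceT.
  exact: bounded_operator_continuous.
move=> _ [v v1 <-]; exists (T v) => //.
by apply: subset_closure; exists v.
Qed.

Lemma compact_operator_compr E F G (S : F -> G) (T : E -> F) :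
  compact_operator S -> bounded_operator T -> compact_operator (S \o T).
Proof.
move=> [Sb Sc] Tb; apply/compact_operatorP; split; first exact: bounded_operator_comp.
have [M M0 TM] := bounded_operatorP Tb.
exists ((fun w => M *: w) @` closure (S @` [set v | `|v| <= 1])).
  apply: continuous_compact => //; apply: continuous_subspaceT.
  exact: scaler_continuous.
move=> _ [v v1 <-]; exists (S (M^-1 *: T v)); last first.
  by rewrite linear_funZ ?scalerA ?divff ?scale1r// ?gt_eqF//; exact: Sb.1.
apply: subset_closure; exists (M^-1 *: T v) => //=.
rewrite normrZ normfV (gtr0_norm M0) ler_pdivrMl// mulr1.
by apply: le_trans (TM v) _; rewrite ler_piMr// ltW.
Qed.

End compact_operators.

(** The image of the unit ball under T is close to its image under S n, which is totally
    bounded; so its closure is totally bounded, and every ultrafilter on it is Cauchy. *)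
Lemma compact_operator_lim (K : numClosedFieldType) (E : normedModType K)
    (F : completeNormedModType K) (S : nat -> E -> F) (T : E -> F) (eps : nat -> K) :
  linear T -> (forall n, compact_operator (S n)) -> (forall n, 0 <= eps n) ->
  (forall e, 0 < e -> exists n, eps n <= e) ->
  (forall n v, `|T v - S n v| <= eps n * `|v|) ->
  compact_operator T.
Proof.
move=> Tlin Sc eps0 epse TS; split.
  split=> //; have [n n1] := epse 1 ltr01; have [[_ [M SM]] _] := Sc n.
  exists (1 + M) => v; rewrite -[T v](subrK (S n v)) mulrDl.
  apply: le_trans (ler_normD _ _) _; apply: lerD => //.
  by apply: le_trans (TS n v) _; exact: ler_wpM2r.
rewrite compact_ultra => G GU GT.
have Gc : cauchy G.
  apply: cauchy_exP => e e0.
  have e3 : 0 < e / 3%:R by rewrite divr_gt0// ltr0n.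
  have [n ne] := epse _ e3; have [_ Snc] := Sc n.
  pose C := closure (S n @` [set v | `|v| <= 1]).
  have := Snc; rewrite compact_cover => /(_ F C (fun p => ball p (e / 3%:R))).
  case=> [p _||D DC Dcov]; first exact: ball_open.
    by move=> p Cp; exists p => //; exact: ballxx.
  apply: contrapT => /forallNP Gnball.
  have Gball p : G (~` ball p e).
    by have [/Gnball|] := in_ultra_setVsetC (ball p e) GU.
  have : G (closure (T @` [set v | `|v| <= 1]) `&` \bigcap_(p in [set` D]) ~` ball p e).
    by apply: filterI => //; apply: filter_bigI => p _; exact: Gball.
  move=> /filter_ex[y [clTy yD]].
  have [_ [[v v1 <-] /ball_sym yv]] := clTy _ (nbhsx_ballx y _ e3).
  have [|p Dp pSv] := Dcov (S n v); first by apply: subset_closure; exists v.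
  apply: (yD p Dp).
  move: yv pSv; rewrite -!ball_normE /= => yv pSv.
  have -> : e = e / 3%:R + (e / 3%:R + e / 3%:R) by field.
  apply: le_lt_trans (ler_distD (S n v) _ _) _; apply: ltrD => //.
  apply: le_lt_trans (ler_distD (T v) _ _) _; apply: ler_ltD => //.
  rewrite distrC; apply: le_trans (TS n v) _; apply: le_trans (ne).
  exact: ler_piMr.
have Gp : cvg G by apply: cauchy_cvg.
exists (lim G); split; last exact: Gp.
apply: (@closed_closure _ (T @` [set v | `|v| <= 1])) => B /Gp GB.
exact: filter_ex (filterI GT GB).
Qed.

(** * A gliding hump *)

Section gliding_hump.
Variables (K : numFieldType) (A : nat -> nat -> K).
Hypotheses (A1 : forall m n, `|A m n| <= 1) (A0 : forall m, A m m != 0).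

Let coef (n : nat) (st : (nat -> K) * K) := if st.1 n == 0 then st.2 else 0.
Let row (n : nat) st m := st.1 m + coef n st * A m n.
Let shrink (n : nat) st := `|row n st n| / (4%:R * (1 + `|row n st n|)).

(** The state before stage n consists of the sums over i < n of c i * A m i, as a
    function of m, and of the largest weight still allowed. A stage spends this weight
    exactly when the diagonal sum would otherwise vanish, and then shrinks it so much
    that the later stages cannot cancel the diagonal sum. *)
Fixpoint hump_state (n : nat) : (nat -> K) * K :=
  if n is n'.+1 then
    let st := hump_state n' in (row n' st, st.2 * shrink n' st)
  else (fun=> 0, 1).

Let c n := coef n (hump_state n).
Let eta n := (hump_state n).2.

Let hump_sum n m : (hump_state n).1 m = \sum_(i < n) c i * A m i.
Proof. by elim: n => [|n IHn] /=; rewrite ?big_ord0// big_ord_recr/= /row IHn. Qed.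

Let row_neq0 n : 0 < eta n -> (hump_state n.+1).1 n != 0.
Proof.
rewrite /= /row /coef => eta0; case: ifPn => [/eqP ->|]; last by rewrite mul0r addr0.
by rewrite add0r mulf_neq0// gt_eqF.
Qed.

Let shrink_gt0 n : 0 < eta n -> 0 < shrink n (hump_state n).
Proof.
move=> /row_neq0 r0; rewrite divr_gt0 ?normr_gt0// mulr_gt0 ?ltr0n//.
by rewrite ltr_pwDl.
Qed.

Let eta_gt0 n : 0 < eta n.
Proof. by elim: n => [|n IHn]; [exact: ltr01 | rewrite /eta /= mulr_gt0// shrink_gt0]. Qed.

Let eta_half n : eta n.+1 <= eta n / 2%:R.
Proof.
rewrite /eta /= ler_pM2l ?eta_gt0// /shrink; set x := `|_|.
have x0 : 0 <= x by exact: normr_ge0.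
rewrite ler_pdivrMr ?mulr_gt0 ?ltr0n ?ltr_pwDl//.
rewrite -subr_ge0 (_ : _ - _ = 2%:R + x); last by field.
by rewrite addr_ge0.
Qed.

Let eta_exp n : eta n <= 2%:R ^- n.
Proof.
elim: n => [|n IHn]; first by rewrite expr0 invr1.
apply: le_trans (eta_half n) _; rewrite exprS invfM mulrC.
by rewrite ler_pM2l ?invr_gt0 ?ltr0n.
Qed.

Let eta_row n : 4%:R * eta n.+1 <= `|(hump_state n.+1).1 n|.
Proof.
rewrite /eta /= /shrink -/(row _ _); set x := `|_|.
have x0 : 0 <= x by exact: normr_ge0.
have e1 : eta n <= 1.
  apply: le_trans (eta_exp n) _.
  by rewrite invf_le1 ?exprn_gt0 ?exprn_ege1 ?ler1n ?ltr0n.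
have -> : 4%:R * ((hump_state n).2 * (x / (4%:R * (1 + x)))) = eta n * (x / (1 + x)).
  by rewrite /eta; field; rewrite gt_eqF// ltr_pwDl.
apply: (@le_trans _ _ (x / (1 + x))).
  by rewrite ler_piMl// divr_ge0// addr_ge0.
by rewrite ler_pdivrMr ?ltr_pwDl// ler_peMr// lerDl.
Qed.

Let c_ge0 n : 0 <= c n.
Proof. by rewrite /c /coef; case: ifP => // _; exact/ltW/eta_gt0. Qed.

Let c_tail n k : \sum_(n <= i < n + k) c i <= 2%:R * eta n - 2%:R * eta (n + k).
Proof.
elim: k => [|k IHk]; first by rewrite addn0 big_geq// subrr.
rewrite addnS big_nat_recr ?leq_addr//=.
apply: le_trans (lerD IHk (_ : _ <= 2%:R * eta (n + k) - 2%:R * eta (n + k).+1)) _; last first.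
  by rewrite subrKA.
apply: (@le_trans _ _ (eta (n + k))).
  by rewrite /c /coef -/(eta _); case: ifP => // _; exact/ltW/eta_gt0.
have := eta_half (n + k); rewrite ler_pdivlMr ?ltr0n// mulrC => h.
rewrite lerBrDr addrC -lerBrDr; apply: le_trans h _.
by rewrite [leRHS](_ : _ = eta (n + k))//; ring.
Qed.

(** The sum in row m becomes nonzero at stage m, of size at least four times the next
    allowed weight, and the remaining weights add up to at most twice that weight. *)
Lemma gliding_hump : exists c : nat -> K, [/\ forall n, 0 <= c n,
  forall n m, \sum_(n <= i < m) c i <= 2%:R * 2%:R ^- n &
  forall m, exists2 d, 0 < d &
    forall n, (m < n)%N -> d <= `|\sum_(i < n) c i * A m i| ].
Proof.
exists c; split=> // [n m|m].
  have [mn|/ltnW nm] := leqP m n.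
    by rewrite big_geq// mulr_ge0// invr_ge0 exprn_ge0.
  rewrite -(subnKC nm); apply: le_trans (c_tail _ _) _.
  apply: (@le_trans _ _ (2%:R * eta n)); last by rewrite ler_pM2l ?ltr0n.
  by rewrite gerBl mulr_ge0// ltW// eta_gt0.
exists (2%:R * eta m.+1); first by rewrite mulr_gt0 ?ltr0n ?eta_gt0.
move=> n mn; rewrite -(big_mkord xpredT (fun i => c i * A m i)).
rewrite (@big_cat_nat _ _ _ m.+1)//= big_mkord -hump_sum.
set p := (_.1 m); set q := \sum_(_ <= _ < _) _.
have q_le : `|q| <= 2%:R * eta m.+1.
  apply: le_trans (ler_norm_sum _ _ _) _.
  apply: (@le_trans _ _ (\sum_(m.+1 <= i < n) c i)).
    by apply: ler_sum => i _; rewrite normrM ger0_norm// ler_piMr.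
  rewrite -(subnKC mn); apply: le_trans (c_tail _ _) _.
  by rewrite gerBl mulr_ge0// ltW// eta_gt0.
have := eta_row m; rewrite -/p => hp.
have : `|p| <= `|p + q| + `|q|.
  by rewrite -[X in `|X| <= _](addrK q); exact: ler_normB.
move=> /(le_trans hp); rewrite -lerBlDr; apply: le_trans.
rewrite lerBrDr; apply: le_trans (lerD (lexx _) q_le) _.
by rewrite [leLHS](_ : _ = 4%:R * eta m.+1)//; ring.
Qed.

End gliding_hump.

(** * Operators of rank one *)

Section rank_one.
Variable R : realType.
Local Open Scope complex_scope.

(** The unit ball is sent into the multiples of b by scalars whose real and imaginary
    parts lie in a segment. *)
Lemma rank_one_compact (E : innerProductModType R[i]) (F : normedModType R[i])
  (a : E) (b : F) : compact_operator (fun v => inner v a *: b).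
Proof.
apply/compact_operatorP; split.
  split=> [k u v|]; first by rewrite innerDl innerZl scalerDl scalerA.
  exists (`|a| * `|b|) => v; rewrite normrZ mulrAC.
  by rewrite ler_wpM2r// mulrC norm_inner.
pose M := complex.Re `|a|; pose I : set R := `[- M, M]%classic.
have Ic : compact I by rewrite /I; apply: segment_compact.
have Mle z : `|z| <= `|a| -> - M <= complex.Re z <= M /\ - M <= complex.Im z <= M.
  have aE : `|a| = M%:C by rewrite RRe_real// normr_real.
  rewrite aE -!ler_norml => za; split; rewrite -lecR; apply: le_trans za.
    exact: normc_ge_Re.
  by rewrite normc_def lecR -[leLHS]sqrtr_sqr ler_wsqrtr// lerDr sqr_ge0.
exists ((fun p : R * R => (p.1%:C + 'i * p.2%:C) *: b) @` (I `*` I)).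
  apply: continuous_compact; last by apply: compact_setX.
  apply: continuous_subspaceT => p; apply: cvgZr_tmp.
  apply: cvgD; first by apply: cvg_real_complex; exact: cvg_fst.
  by apply: cvgMl_tmp; apply: cvg_real_complex; exact: cvg_snd.
move=> _ [v /= v1 <-]; exists (complex.Re (inner v a), complex.Im (inner v a)).
  have [|h1 h2] := Mle (inner v a).
    by apply: le_trans (norm_inner _ _) _; rewrite ler_piMl.
  by split; rewrite /I /= in_itv.
by rewrite /= -complexE.
Qed.

Lemma expn2_le (e : R[i]) : 0 < e -> exists n, forall m, (n <= m)%N ->
  2%:R * 2%:R ^- m <= e.
Proof.
move=> e0; have eE : e = (complex.Re e)%:C by rewrite RRe_real// gtr0_real.
have e'0 : 0 < complex.Re e by move: e0; rewrite {1}eE ltcR.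
exists (Num.bound (2%:R / complex.Re e)) => m nm.
rewrite ler_pdivrMr ?exprn_gt0 ?ltr0n// eE -ler_pdivrMl ?ltcR//.
rewrite -fmorphV -natrX -[2%:R](rmorph_nat (real_complex R)).
rewrite -[(2 ^ m)%:R](rmorph_nat (real_complex R)) -rmorphM lecR mulrC.
have := archi_boundP (divr_ge0 (ler0n R 2) (ltW e'0)) => /ltW/le_trans; apply.
by rewrite ler_nat (leq_trans nm)// ltnW// ltn_expl.
Qed.

(** Used to identify limits of operators with error 2 * 2 ^- n. *)
Lemma normr_le_expn2 (V : normedZmodType R[i]) (v : V) (M : R[i]) :
  (forall n, `|v| <= 2%:R * 2%:R ^- n * M) -> v = 0.
Proof.
move=> vM; apply/eqP; rewrite -normr_eq0 eq_le normr_ge0 andbT.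
apply/ler_addgt0Pl => e e0; rewrite addr0.
have M0 : 0 <= M.
  by have := le_trans (normr_ge0 _) (vM 0); rewrite expr0 divr1 pmulr_rge0// ltr0n.
have M1 : 0 < 1 + M by rewrite ltr_pwDl.
have [n /(_ n (leqnn n))] := expn2_le (divr_gt0 e0 M1).
rewrite ler_pdivlMr// => /(le_trans _); apply; apply: le_trans (vM n) _.
by apply: ler_wpM2l; rewrite ?lerDr// mulr_ge0// invr_ge0 exprn_ge0.
Qed.

End rank_one.

(** * Isomorphisms of algebraic Roe algebras control propagation *)

Section expansive.
Variables (R : realType) (H : hilbertType R[i]).

(** Vectors of norm at most 1 keep the matrix of the gliding hump bounded by 1. *)
Lemma coeff_neq0_unit (X Y : choiceType) (T : l2 X H -> l2 Y H) y x :
  linear T -> coeff T y x <> cst 0 ->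
  exists v h, [/\ `|v| <= 1, `|h| <= 1 & inner (T (l2_delta x v)) (l2_delta y h) != 0].
Proof.
move=> Tlin /coeff_neq0P[v Tv]; set w := T _ y in Tv.
have v0 : `|v| != 0.
  apply: contra_neq Tv => /normr0_eq0 v0; rewrite /w v0.
  by rewrite (linear_fun0 (@l2_delta_linear _ _ _ x)) linear_fun0.
exists (`|v|^-1 *: v), (`|w|^-1 *: w); split.
- by rewrite normrZ normfV normr_id mulVf.
- by rewrite normrZ normfV normr_id mulVf// normr_eq0.
rewrite inner_l2_delta_r (linear_funZ (@l2_delta_linear _ _ _ x)) linear_funZ// l2Z.
rewrite innerZl innerZr inner_norm.
by rewrite !mulf_neq0 ?invr_eq0 ?conjC_eq0 ?expf_neq0 ?invr_eq0 ?normr_eq0// -normr_eq0.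
Qed.

(** The weights c make the series of the operators v |-> <v, a n> b n normally
    convergent. *)
Lemma rank_one_series (X : choiceType) (E : innerProductModType R[i])
    (c : nat -> R[i]) (a : nat -> E) (b : nat -> l2 X H) :
  (forall n, 0 <= c n) -> (forall n, `|a n| <= 1) -> (forall n, `|b n| <= 1) ->
  (forall n m, \sum_(n <= i < m) c i <= 2%:R * 2%:R ^- n) ->
  exists2 T : E -> l2 X H, linear T & forall n v,
    `|T v - \sum_(i < n) (c i * inner v (a i)) *: b i| <= 2%:R * 2%:R ^- n * `|v|.
Proof.
move=> c0 a1 b1 csum.
apply: limit_operator => [n k u v|n|e /expn2_le[n ne]|n m v nm].
- rewrite scaler_sumr -big_split/=; apply: eq_bigr => i _.
  by rewrite innerDl innerZl mulrDr mulrCA scalerDl scalerA.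
- by rewrite mulr_ge0// invr_ge0 exprn_ge0.
- by exists n; exact: ne.
rewrite -!(big_mkord xpredT (fun i => (c i * inner v (a i)) *: b i)).
rewrite (@big_cat_nat _ _ _ n 0%N m)//= addrC addrK.
apply: le_trans (ler_norm_sum _ _ _) _.
apply: (@le_trans _ _ (\sum_(n <= i < m) c i * `|v|)); last first.
  by rewrite -mulr_suml ler_wpM2r.
apply: ler_sum => i _; rewrite normrZ normrM (ger0_norm (c0 i)) -mulrA.
apply: ler_wpM2l => //; apply: (@le_trans _ _ `|inner v (a i)|).
  by rewrite ler_piMr ?normr_ge0 ?b1.
by apply: le_trans (norm_inner _ _) _; rewrite ler_piMr ?a1.
Qed.

(** The support of the sum lies in the pairs (x1 n, x2 n), and each coefficient is a norm
    limit of operators of finite rank. *)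
Lemma rank_one_series_roe (X : metricType R) (r : R) (c : nat -> R[i])
    (x1 x2 : nat -> X) (v1 v2 : nat -> H) (T : l2 X H -> l2 X H) :
  (forall n, mdist (x1 n) (x2 n) <= r) -> linear T ->
  (forall n v, `|T v - \sum_(i < n) (c i * inner v (l2_delta (x2 i) (v2 i))) *:
     l2_delta (x1 i) (v1 i)| <= 2%:R * 2%:R ^- n * `|v|) ->
  algebraic_roe T.
Proof.
move=> x12 Tlin TS.
have coeffTS n x y v : `|coeff T x y v - \sum_(i < n) inner v (l2_delta (x2 i) (v2 i) y) *:
     (c i *: l2_delta (x1 i) (v1 i) x)| <= 2%:R * 2%:R ^- n * `|v|.
  rewrite -(norm_l2_delta y v); apply: le_trans (TS n (l2_delta y v)).
  apply: le_trans (l2_norm_eval _ x); rewrite l2B l2_sum.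
  rewrite le_eqVlt; apply/orP; left; apply/eqP; congr `|_ - _|.
  apply: eq_bigr => i _; rewrite l2Z inner_l2_delta scalerA; congr (_ *: _); exact: mulrC.
split.
- split=> //; exists (2%:R * 2%:R ^- 0) => v.
  by have := TS 0%N v; rewrite big_ord0 subr0.
- apply/finite_propagationP; exists r => x y; apply: contra_notP => /negP rxy.
  apply/funext => v; apply: normr_le_expn2 => n.
  have := coeffTS n x y v; rewrite big1 ?subr0; first exact.
  move=> i _; rewrite !l2_deltaE; case: eqVneq => [yx|_]; last by rewrite inner0r scale0r.
  case: eqVneq => [xx|_]; last by rewrite !scaler0.
  by move: rxy; rewrite xx yx x12.
- move=> x y; apply: (@compact_operator_lim _ _ _ (fun n v => \sum_(i < n)
      inner v (l2_delta (x2 i) (v2 i) y) *: (c i *: l2_delta (x1 i) (v1 i) x)) _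
      (fun n => 2%:R * 2%:R ^- n)) => [k u v|n|n|e /expn2_le[n ne]|n v].
  + by rewrite /coeff l2_delta_linear Tlin.
  + by apply: compact_operator_sum => i; exact: rank_one_compact.
  + by rewrite mulr_ge0// invr_ge0 exprn_ge0.
  + by exists n; exact: ne.
  + exact: coeffTS.
Qed.

(** If the estimate fails for r, the bad quadruples produce by a gliding hump an element T
    of the algebraic Roe algebra whose conjugate has coefficients at unbounded distance. *)
Lemma roe_expansive (X Y : metricType R) (U : unitary (l2 X H) (l2 Y H)) :
  (forall T, algebraic_roe T -> algebraic_roe (unitary_conj U T)) ->
  forall r, exists s, forall x1 x2 y1 y2, mdist x1 x2 <= r ->
    coeff U y1 x1 <> cst 0 -> coeff U y2 x2 <> cst 0 -> mdist y1 y2 <= s.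
Proof.
move=> Uroe r; apply: contrapT => /forallNP Us.
(* A quadruple is packed as q = ((x1, x2), (y1, y2)) with vectors ((v1, v2), (h1, h2)). *)
have {}Us (n : nat) : exists q : (X * X) * (Y * Y) * ((H * H) * (H * H)),
    [/\ mdist q.1.1.1 q.1.1.2 <= r, n%:R < mdist q.1.2.1 q.1.2.2,
        [/\ `|q.2.1.1| <= 1, `|q.2.1.2| <= 1, `|q.2.2.1| <= 1 & `|q.2.2.2| <= 1],
        inner (U (l2_delta q.1.1.1 q.2.1.1)) (l2_delta q.1.2.1 q.2.2.1) != 0 &
        inner (U (l2_delta q.1.1.2 q.2.1.2)) (l2_delta q.1.2.2 q.2.2.2) != 0].
  have := Us n%:R; move=> /existsNP[x1] /existsNP[x2] /existsNP[y1] /existsNP[y2].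
  move=> /not_implyP[x12] /not_implyP[U1] /not_implyP[U2] /negP; rewrite -ltNge => ny12.
  have [v1 [h1 [v11 h11 Uv1]]] := coeff_neq0_unit (@unitary_linear _ _ _ U) U1.
  have [v2 [h2 [v21 h21 Uv2]]] := coeff_neq0_unit (@unitary_linear _ _ _ U) U2.
  by exists (((x1, x2), (y1, y2)), ((v1, v2), (h1, h2))).
have {Us}[q Uq] := choice Us.
pose a n := l2_delta (q n).1.1.2 (q n).2.1.2; pose b n := l2_delta (q n).1.1.1 (q n).2.1.1.
pose xi n := unitary_adj U (l2_delta (q n).1.2.2 (q n).2.2.2).
pose eta n := unitary_adj U (l2_delta (q n).1.2.1 (q n).2.2.1).
have adjN f : `|unitary_adj U f| = `|f| := unitary_norm (unitary_inv U) f.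
have a1 n : `|a n| <= 1 by rewrite norm_l2_delta; have [_ _ []] := Uq n.
have b1 n : `|b n| <= 1 by rewrite norm_l2_delta; have [_ _ []] := Uq n.
have xi1 n : `|xi n| <= 1 by rewrite adjN norm_l2_delta; have [_ _ []] := Uq n.
have eta1 n : `|eta n| <= 1 by rewrite adjN norm_l2_delta; have [_ _ []] := Uq n.
(* A m n is the coefficient of the conjugate of the n-th rank one operator seen by the
   m-th pair (y1, y2). *)
pose A m n := inner (xi m) (a n) * inner (b n) (eta m).
have inner1 (f g : l2 X H) : `|f| <= 1 -> `|g| <= 1 -> `|inner f g| <= 1.
  by move=> f1 g1; apply: le_trans (norm_inner _ _) _; rewrite mulr_ile1.
have A1 m n : `|A m n| <= 1 by rewrite normrM mulr_ile1// inner1.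
have A0 m : A m m != 0.
  have [_ _ _ Ub Ua] := Uq m; rewrite mulf_neq0//; last by rewrite -unitary_adjP.
  by rewrite innerC conjC_eq0 -unitary_adjP.
have [c [c0 csum cA]] := gliding_hump A1 A0.
have [T Tlin TS] := rank_one_series c0 a1 b1 csum.
have q12 n : mdist (q n).1.1.1 (q n).1.1.2 <= r by have [] := Uq n.
have Troe : algebraic_roe T.
  exact: (@rank_one_series_roe X r c _ _ (fun n => (q n).2.1.1)
    (fun n => (q n).2.1.2) T q12 Tlin TS).
have [_ /finite_propagationP[s UTs] _] := Uroe _ Troe.
pose m := Num.bound `|s|.
have sm : s < mdist (q m).1.2.1 (q m).1.2.2.
  have [_ mq _ _ _] := Uq m; apply: le_lt_trans mq.
  by apply: le_trans (ler_norm s) _; exact/ltW/archi_boundP.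
(* The pair number m is farther apart than the propagation s of the conjugate. *)
have T0 : inner (T (xi m)) (eta m) = 0.
  rewrite /eta -(unitary_adjoint U) inner_l2_delta_r.
  rewrite -[U _ _]/(coeff (unitary_conj U T) _ _ _).
  suff -> : coeff (unitary_conj U T) (q m).1.2.1 (q m).1.2.2 = cst 0 by rewrite inner0l.
  by apply: contrapT => /UTs; apply/negP; rewrite -ltNge.
have [d d0 dA] := cA m; have [n ne] := expn2_le (divr_gt0 d0 (ltr0n _ 2)).
pose N := maxn n m.+1; pose SN := \sum_(i < N) (c i * inner (xi m) (a i)) *: b i.
have := dA N (leq_maxr _ _).
have -> : \sum_(i < N) c i * A m i = inner (SN - T (xi m)) (eta m).
  rewrite innerBl T0 subr0 inner_suml; apply: eq_bigr => i _.
  by rewrite innerZl mulrA.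
apply/negP; rewrite -real_ltNge ?(gtr0_real d0) ?normr_real//.
apply: le_lt_trans (norm_inner _ _) _; rewrite distrC.
apply: (@le_lt_trans _ _ (d / 2)); last by rewrite ltr_pdivrMr ?ltr0n// ltr_pMr// ltr1n.
apply: le_trans (ne N (leq_maxl _ _)).
apply: (@le_trans _ _ `|T (xi m) - SN|); first by rewrite ler_piMr ?eta1.
apply: le_trans (TS N (xi m)) _.
by rewrite ler_piMr ?xi1// mulr_ge0// invr_ge0 exprn_ge0.
Qed.

End expansive.

Section roe_iso_covering.
Variables (R : realType) (H : hilbertType R[i]) (X Y : metricType R).

Lemma roe_iso_inv (U : roe_iso H X Y) T :
  algebraic_roe T -> algebraic_roe (unitary_conj (unitary_inv U) T).
Proof.
case: (roe_isoP U) => -[_ _ Usurj] _ _ _ _ /Usurj[S SX <-].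
rewrite (_ : unitary_conj _ _ = S)//; apply/funext => f.
by rewrite /unitary_conj /= !unitary_funK.
Qed.

(** The estimate for U with r = 0 makes any choice of y with a nonzero coefficient at
    (y, x) well defined up to a bounded distance; for general r it makes the choice
    uniformly expansive, and the adjoint of U gives the coarse inverse. *)
Lemma roe_iso_covers (U : roe_iso H X Y) (v : H) : v != 0 ->
  exists2 f : X -> Y, is_coarse_equivalence f & covers U f.
Proof.
move=> v0.
have Uroe T : algebraic_roe T -> algebraic_roe (unitary_conj U T).
  by case: (roe_isoP U) => -[+ _ _] _ _ _ _; apply.
have Uexp := roe_expansive Uroe; have Vexp := roe_expansive (@roe_iso_inv U).
have [f Uf] := choice (fun x => unitary_coeff_ex U x v0).
have [g Vg] := choice (fun y => unitary_coeff_ex (unitary_inv U) y v0).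
have UV x y : coeff U y x <> cst 0 -> coeff (unitary_inv U) x y <> cst 0.
  exact: (coeff_adjoint (unitary_adjoint U)).
have VU x y : coeff (unitary_inv U) x y <> cst 0 -> coeff U y x <> cst 0.
  exact: (coeff_adjoint (unitary_adj_adjoint U)).
have [s Us] := Uexp 0; have [t Vt] := Vexp 0.
exists f; last first.
  by apply/coversP; exists s => x y; apply: (Us x x) (Uf x); rewrite mdistxx.
split.
  apply/uniformly_expansiveP => r; have [c Uc] := Uexp r; exists c => x1 x2 x12.
  exact: Uc x12 (Uf x1) (Uf x2).
exists g; split; [|split].
- apply/uniformly_expansiveP => r; have [c Vc] := Vexp r; exists c => y1 y2 y12.
  exact: Vc y12 (Vg y1) (Vg y2).
- apply/close_mapsP; exists s => y /=.
  by apply: (Us (g y) (g y)); rewrite ?mdistxx//; exact: VU.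
- apply/close_mapsP; exists t => x /=.
  by apply: (Vt (f x) (f x)); rewrite ?mdistxx//; exact: UV.
Qed.

End roe_iso_covering.

(** * Orthonormal bases *)

Definition orthonormal_family (K : numClosedFieldType) (E : innerProductModType K)
    (I : eqType) (e : I -> E) :=
  forall i j, inner (e i) (e j) = (i == j)%:R.

Definition total_family (K : numClosedFieldType) (E : innerProductModType K)
    (I : Type) (e : I -> E) :=
  forall v, (forall i, inner v (e i) = 0) -> v = 0.

Section orthonormal.
Variables (K : numClosedFieldType) (E : innerProductModType K) (I : eqType) (e : I -> E).
Hypothesis eO : orthonormal_family e.

Lemma inner_orthonormal_sum (s : seq I) (c : I -> K) j : uniq s ->
  inner (\sum_(i <- s) c i *: e i) (e j) = if j \in s then c j else 0.
Proof.
move=> s_uniq; rewrite inner_suml.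
under eq_bigr do rewrite innerZl eO.
have [js|js] := boolP (j \in s).
  rewrite (bigD1_seq j)//= eqxx mulr1 big1 ?addr0// => i /negPf ->.
  by rewrite mulr0.
by rewrite big_seq big1// => i si; case: eqP js si => [-> /negPf->|]; rewrite ?mulr0.
Qed.

Lemma norm_orthonormal_sum (s : seq I) (c : I -> K) : uniq s ->
  `|\sum_(i <- s) c i *: e i| ^+ 2 = \sum_(i <- s) `|c i| ^+ 2.
Proof.
move=> s_uniq; rewrite -inner_norm inner_sumr big_seq [RHS]big_seq.
apply: eq_bigr => j js; rewrite innerZr inner_orthonormal_sum// js.
by rewrite normCKC.
Qed.

(** The orthogonal projection p of v satisfies <v, p> = <p, p>; conclude by the
    Cauchy-Schwarz inequality. *)
Lemma bessel (s : seq I) (v : E) : uniq s ->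
  \sum_(i <- s) `|inner v (e i)| ^+ 2 <= `|v| ^+ 2.
Proof.
move=> s_uniq; pose p := \sum_(i <- s) inner v (e i) *: e i.
have vp : inner v p = inner p p.
  rewrite !inner_sumr big_seq [RHS]big_seq; apply: eq_bigr => i si.
  by rewrite !innerZr inner_orthonormal_sum// si.
rewrite -norm_orthonormal_sum// -/p.
rewrite ler_sqrn//; have [->|p0] := eqVneq p 0; first by rewrite normr0.
rewrite -(ler_pM2r (x := `|p|)) ?normr_gt0// -expr2 -inner_norm -vp.
apply: le_trans (norm_inner _ _); rewrite vp inner_norm.
by rewrite ger0_norm// exprn_ge0.
Qed.

End orthonormal.

Section riesz_fischer.
Variables (R : realType) (E : hilbertType R[i]) (I : choiceType) (e : I -> E).
Hypothesis eO : orthonormal_family e.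

(** The partial sums are Cauchy along the finite subsets because the sums of squares have
    a supremum. *)
Lemma riesz_fischer (c : I -> R[i]) (M : R[i]) :
  (forall s : {fset I}, \sum_(i <- s) `|c i| ^+ 2 <= M) ->
  exists2 w, forall i, inner w (e i) = c i & `|w| ^+ 2 <= M.
Proof.
move=> cM; pose S (J : {fset I}) := \sum_(i <- J) c i *: e i.
have c0 i : 0 <= `|c i| ^+ 2 by exact: exprn_ge0.
have M0 : 0 <= M by have := cM fset0; rewrite big_seq_fset0.
pose r J := complex.Re (\sum_(i <- J : {fset I}) `|c i| ^+ 2).
have rE J : ((r J)%:C)%C = \sum_(i <- J) `|c i| ^+ 2.
  by rewrite RRe_real// ger0_real// sumr_ge0.
have supr : has_sup (range r).
  split; first by exists (r fset0), fset0.
  exists (complex.Re M) => _ [J _ <-]; rewrite -lecR rE RRe_real//; exact: ger0_real.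
have Scvg : cvg (S @ totally).
  apply: cauchy_cvg; apply: cauchy_exP => d d0.
  have d2 : 0 < d ^+ 2 by exact: exprn_gt0.
  have dE : ((complex.Re (d ^+ 2))%:C)%C = d ^+ 2 by rewrite RRe_real// gtr0_real.
  have [|_ [J _ <-] Jsup] := sup_adherent (_ : 0 < complex.Re (d ^+ 2)) supr.
    by rewrite -ltcR dE.
  exists (S J), J => // J' /= JJ'; rewrite -ball_normE /= distrC.
  rewrite -(ltr_pXn2r (n := 2)) ?nnegrE ?(ltW d0)//.
  (* The partial sums S J and S J' differ by a sum over D, whose squared norm is r J' - r J. *)
  pose D := [fset i in J' | i \notin J]%fset.
  have J'E (V : nmodType) (g : I -> V) :
      \sum_(i <- J') g i = \sum_(i <- J) g i + \sum_(i <- D) g i.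
    rewrite (big_fsetID _ (mem J))/= (_ : [fset x in J' | x \in J]%fset = J)//.
    apply/fsetP => x; rewrite !inE /= andbC.
    by case xJ: (x \in J) => //=; rewrite (fsubsetP JJ').
  rewrite /S (J'E E) addrC addKr norm_orthonormal_sum ?fset_uniq//.
  have J'sup : r J' <= sup (range r) by apply: ub_le_sup supr.2 _ _; exists J'.
  rewrite -dE -(addKr (\sum_(i <- J) `|c i| ^+ 2) (\sum_(i <- D) _)) -J'E -!rE.
  rewrite addrC -rmorphB ltcR; lra.
have rf_inner i : inner (lim (S @ totally)) (e i) = c i.
  apply/eqP; rewrite -subr_eq0 -normr_eq0 eq_le normr_ge0 andbT.
  apply/ler_addgt0Pl => d d0; rewrite addr0.
  have /cvgrPdist_le/(_ _ d0)[J _ JS] := Scvg.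
  have := JS (i |` J)%fset (fsubsetU1 _ _) => /=; apply: le_trans.
  have -> : inner (lim (S @ totally)) (e i) - c i =
      inner (lim (S @ totally) - S (i |` J)%fset) (e i).
    by rewrite innerBl inner_orthonormal_sum ?fset_uniq// fset1U1.
  apply: le_trans (norm_inner _ _) _.
  have ei : `|e i| = 1.
    by apply/eqP; rewrite -(eqrXn2 (n := 2))// -inner_norm eO eqxx expr1n.
  by rewrite ei mulr1.
exists (lim (S @ totally)) => //.
rewrite -[M]sqrtCK ler_sqrn ?sqrtC_ge0// -[lim _]subr0.
apply: (norm_cvg_le Scvg); near=> J; rewrite subr0.
by rewrite -ler_sqrn ?sqrtC_ge0// sqrtCK norm_orthonormal_sum ?fset_uniq.
Unshelve. all: by end_near. Qed.

End riesz_fischer.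

Section unitary_of_bases.
Variables (R : realType) (I : choiceType).

Lemma basis_transfer (E F : hilbertType R[i]) (a : I -> E) (b : I -> F) :
  orthonormal_family a -> orthonormal_family b ->
  exists U : E -> F, forall v,
    (forall i, inner (U v) (b i) = inner v (a i)) /\ `|U v| <= `|v|.
Proof.
move=> aO bO.
have /choice[U Uab] (v : E) : exists w : F,
    (forall i, inner w (b i) = inner v (a i)) /\ `|w| <= `|v|.
  have [|w wb] := riesz_fischer bO (c := fun i => inner v (a i)) (M := `|v| ^+ 2).
    by move=> s; apply: bessel.
  by rewrite ler_sqrn//; exists w.
by exists U.
Qed.

(** The transfer in each direction is a contraction that preserves all coordinates;
    the two are mutually inverse by totality, hence isometric. *)
Lemma unitary_of_bases (E F : hilbertType R[i]) (a : I -> E) (b : I -> F) :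
  orthonormal_family a -> total_family a ->
  orthonormal_family b -> total_family b ->
  exists U : unitary E F, forall v i, inner (U v) (b i) = inner v (a i).
Proof.
move=> aO aT bO bT.
have [U Uab] := basis_transfer aO bO; have [V Vba] := basis_transfer bO aO.
have ext (G : hilbertType R[i]) (g : I -> G) : total_family g ->
    forall u v, (forall i, inner u (g i) = inner v (g i)) -> u = v.
  by move=> gT u v uv; apply/subr0_eq/gT => i; rewrite innerBl uv subrr.
have UK : cancel U V by move=> v; apply: (ext _ _ aT) => i; rewrite (Vba _).1 (Uab _).1.
have VK : cancel V U by move=> v; apply: (ext _ _ bT) => i; rewrite (Uab _).1 (Vba _).1.
have Ulin : linear U.
  move=> k u v; apply: (ext _ _ bT) => i.
  by rewrite innerDl innerZl !(Uab _).1 innerDl innerZl.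
have Uiso v : `|U v| = `|v|.
  by apply/eqP; rewrite eq_le (Uab _).2 -{1}(UK v) (Vba _).2.
have UV : adjoint U V.
  by move=> u v; rewrite -{1}(VK v) (isometry_inner Ulin Uiso).
by exists (Unitary Ulin UV UK VK) => v i; exact: (Uab v).1.
Qed.

End unitary_of_bases.

Section separable_basis.
Variables (K : numClosedFieldType) (E : innerProductModType K).

Definition orthonormal_set (B : set E) :=
  forall u v, B u -> B v -> inner u v = (u == v)%:R.

(** Zorn's lemma; a vector orthogonal to a maximal orthonormal set could be normalized
    and added to it. *)
Lemma maximal_orthonormal_set : exists2 B : set E, orthonormal_set B &
  forall v, (forall u, B u -> inner v u = 0) -> v = 0.
Proof.
have [|B [BO Bmax]] := @Zorn_bigcup E orthonormal_set.
  move=> F FO Ftot u v [C FC Cu] [D FD Dv].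
  have [CD|DC] := Ftot _ _ FC FD.
    by apply: (FO D) => //; exact: CD.
  by apply: (FO C) => //; exact: DC.
exists B => // v vB; apply/eqP; apply: contrapT => /negP v0.
have nv0 : `|v| != 0 by rewrite normr_eq0.
(* A nonzero v, once normalized, could be added to B. *)
pose w := `|v|^-1 *: v.
have w1 : inner w w = 1.
  by rewrite inner_norm normrZ normfV normr_id mulVf// expr1n.
have wB u : B u -> inner w u = 0 by move=> Bu; rewrite innerZl vB// mulr0.
have Bw : ~ B w by move=> /wB/eqP; rewrite w1 oner_eq0.
apply: (Bmax (B `|` [set w])).
  split; first by left.
  by move=> /(_ w (or_intror erefl)).
have neq u : B u -> (u == w) = false by move=> Bu; apply/eqP => uw; apply: Bw; rewrite -uw.
move=> x y [Bx|->] [By|->]; first exact: BO.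
- by rewrite neq// innerC wB// conjC0.
- by rewrite eq_sym neq// wB.
- by rewrite eqxx.
Qed.

(** Sending each element to a point of a countable dense set within distance 1/2 is
    injective. *)
Lemma orthonormal_set_countable (B : set E) :
  separable_space E -> orthonormal_set B -> countable B.
Proof.
move=> [A Ac Ad] BO.
have /choice[a Aa] (u : E) : exists p, A p /\ `|u - p| < 2^-1.
  have [||p [/= up Ap]] := Ad (ball u 2^-1).
  - by exists u; apply: ballxx; rewrite invr_gt0 ltr0n.
  - exact: ball_open.
  by exists p; split=> //; move: up; rewrite -ball_normE.
have /countable_injP[h hinj] := Ac.
apply/countable_injP; exists (h \o a) => u v; rewrite !inE => Bu Bv /= huv.
have {huv}auv : a u = a v by apply: hinj huv; rewrite inE; apply: (Aa _).1.
apply/eqP; apply: contrapT => /negP/negPf uv.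
(* Distinct elements of B are at distance the square root of 2, hence more than 1. *)
have uv1 : `|u - v| <= 1.
  apply: le_trans (ler_distD (a u) _ _) _.
  rewrite [in X in _ + X]auv [in X in _ + X]distrC.
  have -> : 1 = 2^-1 + 2^-1 :> K by rewrite -[2^-1]mul1r -splitr.
  by apply: lerD; apply/ltW; exact: (Aa _).2.
have : `|u - v| ^+ 2 <= 1 by rewrite expr_le1.
rewrite -inner_norm innerBl !innerBr !BO// !eqxx uv eq_sym uv subr0 sub0r opprK.
by rewrite -[X in _ <= X]addr0 lerD2l ler10.
Qed.

(** A finite total orthonormal set would span. *)
Lemma orthonormal_set_infinite (B : set E) :
  infinite_dimensional E -> orthonormal_set B ->
  (forall v, (forall u, B u -> inner v u = 0) -> v = 0) -> infinite_set B.
Proof.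
move=> Einf BO BT /finite_seqP[s0 BE]; apply: Einf.
pose s := undup s0; have Bs u : u \in s -> B u by rewrite mem_undup BE.
have sB u : B u -> u \in s by rewrite mem_undup BE.
exists (size s), (fun i => s`_i) => v; exists (fun i => inner v s`_i).
rewrite -(big_mkord xpredT (fun i => inner v s`_i *: s`_i)).
rewrite -(big_nth 0 xpredT (fun u => inner v u *: u)).
apply/subr0_eq/BT => u Bu; rewrite innerBl inner_suml (bigD1_seq u) ?undup_uniq ?sB//=.
rewrite innerZl (BO u u)// eqxx mulr1 big_seq_cond big1 ?addr0 ?subrr// => w /andP[ws /negPf wu].
by rewrite innerZl (BO w u) ?wu ?mulr0//; exact: Bs.
Qed.

Lemma orthonormal_basis : separable_space E -> infinite_dimensional E ->
  exists2 e : nat -> E, orthonormal_family e & total_family e.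
Proof.
move=> Esep Einf; have [B BO BT] := maximal_orthonormal_set.
have := eq_card_nat (orthonormal_set_countable Esep BO) (orthonormal_set_infinite Einf BO BT).
rewrite card_eq_sym => /card_set_bijP[e [eB einj esurj]].
exists e => [i j|v ve].
  rewrite BO; [|exact: eB|exact: eB]; congr (_%:R); congr nat_of_bool.
  by apply/eqP/eqP => [/einj|->//]; apply; rewrite inE.
by apply: BT => u /esurj[i _ <-].
Qed.

End separable_basis.

(** * Covering a coarse equivalence by a unitary *)

Section bounded_geometry_sets.
Variables (R : realType) (X : ubg_space R).

Lemma ubg_finite_ball (x : X) (r : R) : finite_set [set y | mdist x y <= r].
Proof.
have [N XN] := @ubg_geometry R X `|r| (normr_ge0 r).
apply: (@sub_finite_set _ _ [set y | mdist x y <= `|r|]).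
  by move=> y /= xy; apply: le_trans xy (ler_norm r).
by apply/finite_set_leP; exists N.
Qed.

Lemma ubg_countable : countable [set: X].
Proof.
have [->|/set0P[x _]] := eqVneq [set: X] set0; first exact: countable0.
rewrite (_ : [set: X] = \bigcup_(n in [set: nat]) [set y | mdist x y <= n%:R]).
  apply: bigcup_countable => // n _; apply: finite_set_countable.
  exact: ubg_finite_ball.
apply/seteqP; split=> // y _; exists (Num.bound (mdist x y)) => //=.
by apply/ltW/archi_boundP; exact: mdist_ge0.
Qed.

End bounded_geometry_sets.

Lemma infinite_countable_bij T U (A : set T) (B : set U) :
  countable A -> infinite_set A -> countable B -> infinite_set B ->
  exists f : T -> U, set_bij A B f.
Proof.
move=> Ac Ai; elim/Ppointed: U => U in B *.
  by rewrite !emptyE => _ /(_ (finite_set0 _)).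
move=> Bc Bi; apply/card_set_bijP; apply: card_eq_trans (eq_card_nat Ac Ai) _.
by rewrite card_eq_sym; exact: eq_card_nat.
Qed.

Lemma infinite_section (T : Type) (S : set (T * nat)) t :
  (forall n, S (t, n)) -> infinite_set S.
Proof.
move=> St /(@finite_image _ _ _ snd) Sfin; apply: infinite_nat.
by apply: sub_finite_set Sfin => n _; exists (t, n).
Qed.

(** Both products split into blocks indexed by the image of f: the fibres of f on the
    left, those of a retraction p of Y onto the image of f on the right. Each block is
    countably infinite. *)
Lemma coarse_bijection (R : realType) (X Y : ubg_space R) (f : X -> Y) :
  is_coarse_equivalence f ->
  exists2 phi : X * nat -> Y * nat, bijective phi &
    exists c, forall q, mdist (f q.1) (phi q).1 <= c.
Proof.
move=> [_ [g [_ [[c c0 fg] _]]]].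
(* p retracts Y onto the image of f and moves points by at most c. *)
pose p y := if y \in range f then y else f (g y).
have pf y : range f (p y) by rewrite /p; case: ifPn => [|_]; [rewrite inE | exists (g y)].
have pc y : mdist (p y) y <= c.
  by rewrite /p; case: ifP => _; [rewrite mdistxx ltW | exact: fg].
pose A z := [set q : X * nat | f q.1 = z]; pose B z := [set q : Y * nat | p q.1 = z].
have cX (T : ubg_space R) (S : set (T * nat)) : countable S.
  apply: (@sub_countable _ _ _ [set: T * nat]); first exact: card_leT.
  by rewrite -setXTT; apply: countableX => //; exact: ubg_countable.
have /choice[F Fbij] z : exists F : X * nat -> Y * nat, set_bij (A z) (B z) F.
  have [[x _ fx]|zf] := pselect (range f z).
    apply: infinite_countable_bij; [exact: cX| |exact: cX|].
      by apply: (@infinite_section _ _ x).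
    by apply: (@infinite_section _ _ z) => n; rewrite /B /= /p mem_set//; exists x.
  exists (fun q => (z, q.2)); split=> [q fq|q r|r pr].
  - by case: zf; exists q.1.
  - by rewrite inE => fq; case: zf; exists q.1.
  - by case: zf; rewrite -pr; exact: pf.
have Fp q : p (F (f q.1) q).1 = f q.1 by have [Ff _ _] := Fbij (f q.1); exact: Ff.
exists (fun q => F (f q.1) q); last first.
  by exists c => q; have := pc (F (f q.1) q).1; rewrite Fp.
rewrite -setTT_bijective; split=> // [q r _ _ Fqr|r _].
  have qr : f q.1 = f r.1 by rewrite -Fp Fqr Fp.
  have [_ Finj _] := Fbij (f q.1); apply: Finj; rewrite ?inE ?qr//.
  by rewrite -Fqr qr.
have [_ _ Fsurj] := Fbij (p r.1).
have [q fq Fq] := Fsurj r erefl.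
by exists q => //; rewrite (fq : f q.1 = _).
Qed.

Section unitary_of_coarse.
Variables (R : realType) (H : hilbertType R[i]) (e : nat -> H).
Hypotheses (eO : orthonormal_family e) (eT : total_family e).

Lemma l2_delta_orthonormal (X : choiceType) (I : eqType) (h : I -> X * nat) :
  injective h -> orthonormal_family (fun i => l2_delta (h i).1 (e (h i).2)).
Proof.
move=> hinj i j; rewrite inner_l2_delta l2_deltaE -(inj_eq hinj) -pair_eqE /=.
by case: eqP => // _; rewrite ?inner0r ?eO.
Qed.

Lemma l2_delta_total (X : choiceType) (I : Type) (h : I -> X * nat) h' :
  cancel h' h -> total_family (fun i => l2_delta (h i).1 (e (h i).2)).
Proof.
move=> h'K f fe; apply: l2_ext => x; apply: eT => n.
by have := fe (h' (x, n)); rewrite h'K inner_l2_delta_r.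
Qed.

(** The unitary sends the basis vector e n at x to the basis vector at phi (x, n). *)
Lemma coarse_covered (X Y : ubg_space R) (f : X -> Y) :
  is_coarse_equivalence f -> exists U : unitary (l2 X H) (l2 Y H), covers U f.
Proof.
move=> /coarse_bijection[phi [psi phiK psiK] [c fphi]].
have [] := @unitary_of_bases R (X * nat)%type (l2 X H) (l2 Y H)
  (fun q => l2_delta q.1 (e q.2)) (fun q => l2_delta (phi q).1 (e (phi q).2)).
- exact: (l2_delta_orthonormal (h := id)).
- exact: (l2_delta_total (h := id) (h' := id)).
- exact: l2_delta_orthonormal (can_inj phiK).
- exact: l2_delta_total psiK.
move=> U Uphi; exists U; apply/coversP; exists c => x y /coeff_neq0P[v Uv].
have [j Uvj] : exists j, inner (U (l2_delta x v) y) (e j) != 0.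
  apply: contrapT => /forallNP h; move/eqP: Uv; apply; apply: eT => j.
  by have /negP/negPn/eqP := h j.
move: Uvj (Uphi (l2_delta x v) (psi (y, j))); rewrite psiK /= inner_l2_delta_r => Uvj.
rewrite inner_l2_delta l2_deltaE; case: eqP => [-> _|_].
  by have := fphi (psi (y, j)); rewrite psiK.
by rewrite inner0r => /eqP; rewrite (negPf Uvj).
Qed.

End unitary_of_coarse.

(** * Coverings implement isomorphisms of algebraic Roe algebras *)

Section covering_is_roe.
Variables (R : realType) (H : hilbertType R[i]).

Lemma unitary_bounded (E F : innerProductModType R[i]) (U : unitary E F) :
  bounded_operator U.
Proof.
split; first exact: unitary_linear.
by exists 1 => v; rewrite unitary_norm mul1r.
Qed.

Lemma coeff_bounded (X Y : choiceType) (T : l2 X H -> l2 Y H) y x :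
  bounded_operator T -> bounded_operator (coeff T y x).
Proof.
move=> [Tlin [M TM]]; split; first by move=> a u v; rewrite /coeff l2_delta_linear Tlin.
exists M => v; rewrite -(norm_l2_delta x v); apply: le_trans (TM _).
exact: l2_norm_eval.
Qed.

Lemma column_finite_support (X Y : choiceType) (T : l2 X H -> l2 Y H) x v (J : {fset Y}) :
  (forall y, coeff T y x <> cst 0 -> y \in J) ->
  T (l2_delta x v) = \sum_(y <- J) l2_delta y (coeff T y x v).
Proof.
move=> TJ; apply: l2_finite_support => y Ty; apply: TJ.
by apply/coeff_neq0P; exists v.
Qed.

Lemma finite_fset_ex (X : choiceType) (A : set X) : finite_set A ->
  exists J : {fset X}, forall x, A x -> x \in J.
Proof. by move=> Afin; exists (fset_set A) => x Ax; rewrite in_fset_set// mem_set. Qed.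

Lemma finite_propagation_column (X : ubg_space R) (T : l2 X H -> l2 X H) :
  finite_propagation T -> forall x', exists J : {fset X},
  forall x, coeff T x x' <> cst 0 -> x \in J.
Proof.
move=> /finite_propagationP[s Ts] x'.
have [J XJ] := finite_fset_ex (ubg_finite_ball x' s).
by exists J => x /Ts xx'; apply: XJ; rewrite /= metric_sym.
Qed.

(** The points x whose image is near y form a bounded set, which bounded geometry makes
    finite. *)
Lemma covers_row (X Y : ubg_space R) (U : unitary (l2 X H) (l2 Y H)) (f : X -> Y) :
  is_coarse_equivalence f -> covers U f -> forall y, exists J : {fset X},
  forall x, coeff U y x <> cst 0 -> x \in J.
Proof.
move=> /coarse_equivalence_proper fprop [c _ Uf] y.
have [[x0 Ux0]|noU] := pselect (exists x, coeff U y x <> cst 0); last first.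
  by exists fset0 => x Ux; case: noU; exists x.
have [s fs] := fprop (c + c); have [J XJ] := finite_fset_ex (ubg_finite_ball x0 s).
exists J => x /Uf fxy; apply/XJ/fs; apply: le_trans (metric_triangle _ y _) _.
by apply: lerD; [exact: Uf | rewrite metric_sym].
Qed.

(** By bounded geometry each coefficient of the conjugate is a finite sum of products
    U_yx T_xx' V_x'y', where V is the adjoint of U, from which the propagation bound
    and compactness are read. *)
Lemma covers_conj_roe (X Y : ubg_space R) (U : unitary (l2 X H) (l2 Y H)) (f : X -> Y) :
  is_coarse_equivalence f -> covers U f ->
  forall T, algebraic_roe T -> algebraic_roe (unitary_conj U T).
Proof.
move=> fce Uf T [Tb Tprop Tc].
have [J UJ] := choice (covers_row fce Uf).
have [L TL] := choice (finite_propagation_column Tprop).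
have [c _ Uc] := Uf; have /finite_propagationP[s Ts] := Tprop.
have [/uniformly_expansiveP/(_ s)[t ft] _] := fce.
have V_U x y : coeff (unitary_adj U) x y <> cst 0 -> coeff U y x <> cst 0.
  exact: (coeff_adjoint (unitary_adj_adjoint U)).
have conjE y y' : coeff (unitary_conj U T) y y' =
    fun h => \sum_(x' <- J y') \sum_(x <- L x')
      coeff U y x (coeff T x x' (coeff (unitary_adj U) x' y' h)).
  apply/funext => h; rewrite -[LHS]/(U (T (unitary_adj U (l2_delta y' h))) y).
  rewrite (@column_finite_support _ _ (unitary_adj U) _ h (J y')); last first.
    by move=> x' /V_U; exact: UJ.
  rewrite (linear_fun_sum Tb.1) (linear_fun_sum (@unitary_linear _ _ _ U)) l2_sum.
  apply: eq_bigr => x' _; rewrite (column_finite_support _ (TL x')).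
  by rewrite (linear_fun_sum (@unitary_linear _ _ _ U)) l2_sum.
split.
- have [M M0 TM] := bounded_operatorP Tb; split.
    by move=> a u v; rewrite /unitary_conj /= unitary_linear_adj Tb.1 unitary_linear.
  exists M => v; rewrite /unitary_conj /= unitary_norm; apply: le_trans (TM _) _.
  by rewrite (unitary_norm (unitary_inv U)).
- apply/finite_propagationP; exists (c + t + c) => y y'; apply: contra_notP => yy'.
  rewrite conjE; apply/funext => h; apply: big1 => x' _; apply: big1 => x _ /=.
  apply: contrapT => /eqP h0; apply: yy'.
  have U0 := linear_fun0 (coeff_bounded y x (unitary_bounded U)).1.
  have Uyx : coeff U y x <> cst 0 by move=> Z; move: h0; rewrite Z eqxx.
  have Txx' : coeff T x x' <> cst 0 by move=> Z; move: h0; rewrite Z U0 eqxx.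
  have Ux'y' : coeff U y' x' <> cst 0.
    apply: V_U => Z; move: h0.
    by rewrite Z (linear_fun0 (coeff_bounded x x' Tb).1) U0 eqxx.
  apply: le_trans (metric_triangle _ (f x') _) _; apply: lerD; last exact: Uc.
  apply: le_trans (metric_triangle _ (f x) _) _; apply: lerD.
    by rewrite metric_sym; exact: Uc.
  exact/ft/Ts.
- move=> y y'; rewrite conjE; apply: compact_operator_sum => x'.
  apply: compact_operator_sum => x; apply: compact_operator_compl.
    exact: coeff_bounded (unitary_bounded U).
  apply: compact_operator_compr => //.
  exact: coeff_bounded (unitary_bounded (unitary_inv U)).
Qed.

Lemma conj_star_isomorphism (E F : innerProductModType R[i]) (U : unitary E F)
    (A : set (E -> E)) (B : set (F -> F)) :
  (forall T, A T -> B (unitary_conj U T)) ->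
  (forall T, B T -> A (unitary_conj (unitary_inv U) T)) ->
  star_isomorphism A B (unitary_conj U).
Proof.
move=> AB BA; split.
- split=> // [S T _ _ ST|T /BA AT].
    apply/funext => v; have := congr1 (fun T => unitary_adj U (T (U v))) ST.
    by rewrite /unitary_conj /= !unitary_funK.
  exists (unitary_conj (unitary_inv U) T) => //.
  by apply/funext => v; rewrite /unitary_conj /= !unitary_adjK.
- move=> S T _ _; apply/funext => v; rewrite /unitary_conj /=.
  by rewrite (linear_funD (@unitary_linear _ _ _ U)).
- move=> a T _; apply/funext => v; rewrite /unitary_conj /=.
  by rewrite (linear_funZ (@unitary_linear _ _ _ U)).
- by move=> S T _ _; apply/funext => v; rewrite /unitary_conj /= unitary_funK.
- move=> S T _ _ ST u v; rewrite /unitary_conj /= unitary_adjP ST.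
  by rewrite (unitary_adj_adjoint U).
Qed.

(** The adjoint of U covers a coarse inverse of f, so conjugation preserves the Roe
    algebras in both directions. *)
Lemma covers_roe_iso (X Y : ubg_space R) (U : unitary (l2 X H) (l2 Y H)) (f : X -> Y) :
  is_coarse_equivalence f -> covers U f ->
  star_isomorphism (algebraic_roe (H := H) (X := X)) (algebraic_roe (X := Y))
    (unitary_conj U).
Proof.
move=> fce Uf; have [fexp [g [gexp [fg gf]]]] := fce.
apply: conj_star_isomorphism; first exact: covers_conj_roe Uf.
apply: covers_conj_roe (covers_inv gexp gf Uf).
by split=> //; exists f.
Qed.

End covering_is_roe.

(** * The two quotient categories *)

(** The object parts are syntactically the same, which avoids transporting morphisms
    along an equality of objects. *)
Lemma functor_ext (C D : category) (F0 : C -> D)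
    (F1 G1 : forall X Y, mor X Y -> mor (F0 X) (F0 Y))
    (F1P : functorial F1) (G1P : functorial G1) :
  (forall X Y (f : mor X Y), F1 X Y f = G1 X Y f) -> Functor F1P = Functor G1P.
Proof.
move=> FG; have {}FG : F1 = G1.
  by apply: functional_extensionality_dep => X; apply: functional_extensionality_dep => Y;
    apply/funext => f; exact: FG.
by case: _ / FG G1P => G1P; congr Functor; exact: Prop_irrelevance.
Qed.

Section rigidity.
Variables (R : realType) (H : hilbertType R[i]).
Hypotheses (Hsep : separable_space H) (Hinf : infinite_dimensional H).

Lemma roe_covers_ex (X Y : ubg_space R) (U : @mor (roe_category0 H) X Y) :
  exists f : @mor (coarse_category0 R) X Y, covers U f.
Proof.
have [v v0] := infinite_dimensional_neq0 Hinf.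
have [f fce Uf] := roe_iso_covers U v0.
by exists (CoarseEquivalence fce).
Qed.

Lemma coarse_covered_ex (X Y : ubg_space R) (f : @mor (coarse_category0 R) X Y) :
  exists U : @mor (roe_category0 H) X Y, covers U f.
Proof.
have [e eO eT] := orthonormal_basis Hsep Hinf.
have [U Uf] := coarse_covered eO eT (coarse_funP f).
by exists (RoeIso (covers_roe_iso (coarse_funP f) Uf)).
Qed.

(** This equivalence transports every property of closeness between the two categories. *)
Lemma close_coversP (X Y : ubg_space R) (U V : @mor (roe_category0 H) X Y)
    (f g : @mor (coarse_category0 R) X Y) :
  covers U f -> covers V g -> (close_roe0 U V <-> close_coarse0 f g).
Proof.
move=> Uf Vg; have [v v0] := infinite_dimensional_neq0 Hinf; split.
  exact: (covers_close_maps v0 (coarse_funP f).1 Uf Vg).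
exact: (covers_close_unitary (coarse_funP f) Uf Vg).
Qed.

Lemma covers_mor_comp (X Y Z : ubg_space R) (U : @mor (roe_category0 H) X Y)
    (V : @mor (roe_category0 H) Y Z) (f : @mor (coarse_category0 R) X Y)
    (g : @mor (coarse_category0 R) Y Z) :
  covers U f -> covers V g -> @covers R H X Z (mor_comp V U) (mor_comp g f).
Proof. exact: covers_comp (coarse_funP g).1. Qed.

(** Each law is the corresponding law for the covered coarse equivalences. Thus the
    compatibility with composition, a statement about conjugates of finite propagation
    operators, reduces to the triangle inequality. *)
Lemma close_roe_congruence : congruence (@close_roe0 R H).
Proof.
have cP := close_coarse_congruence R.
split=> [X Y U|X Y U V|X Y U V W|X Y Z V V' U U'].
- have [f Uf] := roe_covers_ex U.
  by apply/(close_coversP Uf Uf); exact: cong_refl cP _ _ _.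
- have [[f Uf] [g Vg]] := (roe_covers_ex U, roe_covers_ex V).
  by move=> /(close_coversP Uf Vg)/(cong_sym cP)/(close_coversP Vg Uf).
- have [[f Uf] [g Vg]] := (roe_covers_ex U, roe_covers_ex V).
  have [h Wh] := roe_covers_ex W.
  move=> /(close_coversP Uf Vg) fg /(close_coversP Vg Wh) gh.
  by apply/(close_coversP Uf Wh); exact: (cong_trans cP fg gh).
- have [[f Uf] [f' Uf']] := (roe_covers_ex U, roe_covers_ex U').
  have [[g Vg] [g' Vg']] := (roe_covers_ex V, roe_covers_ex V').
  move=> /(close_coversP Vg Vg') gg' /(close_coversP Uf Uf') ff'.
  apply/(close_coversP (covers_mor_comp Uf Vg) (covers_mor_comp Uf' Vg')).
  exact: (cong_comp cP gg' ff').
Qed.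

Let C : category := coarse_category R.
Let D : category := roe_category close_roe_congruence.

(** The class of the coarse equivalences covered by a representative; it does not depend
    on the choices by [covered_classE]. *)
Definition covered_class (X Y : ubg_space R) (U : @mor D X Y) : @mor C X Y :=
  mor_class (close_coarse_congruence R) (sval (cid (roe_covers_ex (mor_repr U)))).

Definition covering_class (X Y : ubg_space R) (f : @mor C X Y) : @mor D X Y :=
  mor_class close_roe_congruence (sval (cid (coarse_covered_ex (mor_repr f)))).

Lemma covered_classE (X Y : ubg_space R) (U : @mor (roe_category0 H) X Y)
    (f : @mor (coarse_category0 R) X Y) : covers U f ->
  covered_class (mor_class close_roe_congruence U) = mor_class (close_coarse_congruence R) f.
Proof.
move=> Uf; apply/mor_classP; case: cid => g /= Vg.
by apply/(close_coversP Vg Uf); exact: (mor_repr_class close_roe_congruence).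
Qed.

Lemma covering_classE (X Y : ubg_space R) (f : @mor (coarse_category0 R) X Y)
    (U : @mor (roe_category0 H) X Y) : covers U f ->
  covering_class (mor_class (close_coarse_congruence R) f) = mor_class close_roe_congruence U.
Proof.
move=> Uf; apply/mor_classP; case: cid => V /= Vg.
by apply/(close_coversP Vg Uf); exact: (mor_repr_class (close_coarse_congruence R)).
Qed.

Lemma covered_functorial : @functorial D C id covered_class.
Proof.
split=> [X|X Y Z V U]; first exact:
    (@covered_classE X X (@mor_id (roe_category0 H) X)
      (@mor_id (coarse_category0 R) X) (covers_id H X)).
rewrite -[V]mor_reprK -[U]mor_reprK.
have [[f Uf] [g Vg]] := (roe_covers_ex (mor_repr U), roe_covers_ex (mor_repr V)).
rewrite (covered_classE Uf) (covered_classE Vg) /= !quotient_compE.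
exact: (covered_classE (covers_mor_comp Uf Vg)).
Qed.

Lemma covering_functorial : @functorial C D id covering_class.
Proof.
split=> [X|X Y Z g f]; first exact:
    (@covering_classE X X (@mor_id (coarse_category0 R) X)
      (@mor_id (roe_category0 H) X) (covers_id H X)).
rewrite -[g]mor_reprK -[f]mor_reprK.
have [U Uf] := coarse_covered_ex (mor_repr f).
have [V Vg] := coarse_covered_ex (mor_repr g).
rewrite (covering_classE Uf) (covering_classE Vg) /= !quotient_compE.
exact: (covering_classE (covers_mor_comp Uf Vg)).
Qed.

Lemma covered_covering_inverse :
  mutually_inverse (Functor covered_functorial) (Functor covering_functorial).
Proof.
split; apply: functor_ext => X Y a /=; rewrite -[a]mor_reprK.
  have [f Uf] := roe_covers_ex (mor_repr a).
  by rewrite (covered_classE Uf) (covering_classE Uf).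
have [U Uf] := coarse_covered_ex (mor_repr a).
by rewrite (covering_classE Uf) (covered_classE Uf).
Qed.

End rigidity.

Theorem theoremA5 (R : realType) (H : hilbertType R[i])
    (Hsep : separable_space H) (Hinf : infinite_dimensional H) :
  exists closeP : congruence (@close_roe0 R H),
  [/\ (forall (X Y : ubg_space R) (U : @mor (roe_category0 H) X Y),
         exists f : @mor (coarse_category0 R) X Y, covers U f)
      /\ (forall (X Y : ubg_space R) (U V : @mor (roe_category0 H) X Y)
            (f g : @mor (coarse_category0 R) X Y),
            close_roe0 U V -> covers U f -> covers V g -> close_coarse0 f g),
      (forall (X Y : ubg_space R) (f : @mor (coarse_category0 R) X Y),
         exists U : @mor (roe_category0 H) X Y, covers U f)
      /\ (forall (X Y : ubg_space R) (f g : @mor (coarse_category0 R) X Y)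
            (U V : @mor (roe_category0 H) X Y),
            close_coarse0 f g -> covers U f -> covers V g -> close_roe0 U V)
    & exists
        (F : forall X Y : ubg_space R,
           @mor (roe_category closeP) X Y -> @mor (coarse_category R) X Y)
        (G : forall X Y : ubg_space R,
           @mor (coarse_category R) X Y -> @mor (roe_category closeP) X Y)
        (Ffunctor : @functorial (roe_category closeP) (coarse_category R) id F)
        (Gfunctor : @functorial (coarse_category R) (roe_category closeP) id G),
      [/\ forall (X Y : ubg_space R) (U : @mor (roe_category0 H) X Y)
            (f : @mor (coarse_category0 R) X Y),
            covers U f ->
            F X Y (mor_class closeP U) = mor_class (close_coarse_congruence R) f,
          forall (X Y : ubg_space R) (f : @mor (coarse_category0 R) X Y)
            (U : @mor (roe_category0 H) X Y),
            covers U f ->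
            G X Y (mor_class (close_coarse_congruence R) f) = mor_class closeP U
        & mutually_inverse (Functor Ffunctor) (Functor Gfunctor)]].
Proof.
exists (close_roe_congruence Hinf); split.
- split; first exact: roe_covers_ex.
  by move=> X Y U V f g UV Uf Vg; exact/(close_coversP Hinf Uf Vg).
- split; first exact: coarse_covered_ex.
  by move=> X Y f g U V fg Uf Vg; exact/(close_coversP Hinf Uf Vg).
exists (@covered_class R H Hinf), (@covering_class R H Hsep Hinf).
exists (covered_functorial Hinf), (covering_functorial Hsep Hinf).
split; [exact: covered_classE | exact: covering_classE |].
exact: covered_covering_inverse.
Qed.
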